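(* Let $\Sigma$ be a finite alphabet with at least two symbols and let $z\in\{C,B,A,\delta\}$. Then the topology $\tau_z$ on $\Sigma^{\mathbb{N}}$ is Polish and zero-dimensional.
   Context: $\Sigma^{\mathbb{N}}$ is the set of infinite words over $\Sigma$. For a finite word $w\in\Sigma^*$, $N_w=\{\sigma\in\Sigma^{\mathbb{N}}: w \text{ is a prefix of } \sigma\}$. $\tau_C$ is the Cantor (product of discrete) topology, with basis the sets $N_w$. A Büchi automaton is $\mathcal{A}=(\Sigma,Q,Q_i,Q_f,\delta)$ with finite state set $Q$, initial states $Q_i$, final states $Q_f$, transitions $\delta\subseteq Q\times\Sigma\times Q$; a run on $\sigma$ is $(q_n)_{n}\in Q^{\mathbb{N}}$ with $q_0\in Q_i$ and $(q_n,\sigma(n),q_{n+1})\in\delta$ for all $n$; it is accepting if $q_n\in Q_f$ for infinitely many $n$; $L(\mathcal{A})$ is the set of words having an accepting run. A set $L\subseteq\Sigma^{\mathbb{N}}$ is $\omega$-regular if $L=L(\mathcal{A})$ for some Büchi automaton $\mathcal{A}$. $\tau_B$ (Büchi topology) is the topology generated by the $\omega$-regular languages; $\tau_A$ (automatic topology) is the topology generated by the $\omega$-regular languages that are $\tau_C$-closed; $\tau_\delta$ is the topology generated by the effectively Borel (${\it\Delta}^1_1$, with respect to a fixed recursive presentation of $(\Sigma^{\mathbb{N}},\tau_C)$) subsets of $\Sigma^{\mathbb{N}}$, which are exactly the sets accepted by unambiguous Büchi Turing machines (those for which every input has at most one accepting run). *)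

(* Defs.v *)
From Stdlib Require Import Reals List.
From mathcomp Require Import all_boot.

Set Implicit Arguments.
Unset Strict Implicit.
Unset Printing Implicit Defensive.

Definition word (Sigma : Type) := nat -> Sigma.

Definition cyl (Sigma : Type) (w : seq Sigma) : word Sigma -> Prop :=
  fun s => mkseq s (size w) = w.

Inductive generated_open (X : Type) (F : (X -> Prop) -> Prop) :
    (X -> Prop) -> Prop :=
| go_base U : F U -> generated_open F U
| go_full : generated_open F (fun _ => True)
| go_inter U V : generated_open F U -> generated_open F V ->
    generated_open F (fun x => U x /\ V x)
| go_union (G : (X -> Prop) -> Prop) :
    (forall U, G U -> generated_open F U) ->
    generated_open F (fun x => exists U, G U /\ U x)
| go_ext U V : generated_open F U -> (forall x, U x <-> V x) ->
    generated_open F V.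

Definition closed_in (X : Type) (T : (X -> Prop) -> Prop) (U : X -> Prop) :=
  T (fun x => ~ U x).

Definition zero_dimensional (X : Type) (T : (X -> Prop) -> Prop) : Prop :=
  forall U x, T U -> U x ->
    exists V, T V /\ closed_in T V /\ V x /\ (forall y, V y -> U y).

Definition is_metric (X : Type) (d : X -> X -> R) : Prop :=
  (forall x y, Rle R0 (d x y)) /\
  (forall x y, d x y = R0 <-> x = y) /\
  (forall x y, d x y = d y x) /\
  (forall x y z, Rle (d x z) (Rplus (d x y) (d y z))).

Definition metric_open (X : Type) (d : X -> X -> R) (U : X -> Prop) : Prop :=
  forall x, U x -> exists eps, Rlt R0 eps /\ forall y, Rlt (d x y) eps -> U y.

Definition cauchy_seq (X : Type) (d : X -> X -> R) (u : nat -> X) : Prop :=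
  forall eps, Rlt R0 eps -> exists N, forall m n,
    (N <= m)%N -> (N <= n)%N -> Rlt (d (u m) (u n)) eps.

Definition converges_to (X : Type) (d : X -> X -> R) (u : nat -> X) (l : X) :=
  forall eps, Rlt R0 eps -> exists N, forall n, (N <= n)%N -> Rlt (d (u n) l) eps.

Definition complete_metric (X : Type) (d : X -> X -> R) : Prop :=
  forall u, cauchy_seq d u -> exists l, converges_to d u l.

Definition separable_metric (X : Type) (d : X -> X -> R) : Prop :=
  exists D : nat -> X, forall x eps, Rlt R0 eps -> exists n, Rlt (d x (D n)) eps.

Definition polish (X : Type) (T : (X -> Prop) -> Prop) : Prop :=
  exists d : X -> X -> R,
    is_metric d /\ complete_metric d /\ separable_metric d /\
    (forall U, T U <-> metric_open d U).

Record buchi (Sigma : finType) := Buchi {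
  bstate : finType;
  binit : pred bstate;
  bfinal : pred bstate;
  btrans : bstate -> Sigma -> bstate -> bool
}.

Definition is_run (Sigma : finType) (A : buchi Sigma) (s : word Sigma)
    (r : nat -> bstate A) : Prop :=
  @binit _ A (r 0) /\ forall n, @btrans _ A (r n) (s n) (r n.+1).

Definition accepting_run (Sigma : finType) (A : buchi Sigma)
    (r : nat -> bstate A) : Prop :=
  forall m, exists n, (m <= n)%N /\ @bfinal _ A (r n).

Definition buchi_lang (Sigma : finType) (A : buchi Sigma) : word Sigma -> Prop :=
  fun s => exists r, @is_run _ A s r /\ @accepting_run _ A r.

Definition omega_regular (Sigma : finType) (L : word Sigma -> Prop) : Prop :=
  exists A : buchi Sigma, forall s, L s <-> buchi_lang A s.

Inductive prf : Type :=
| PZero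
| PSucc
| PProj (i : nat)
| PComp (f : prf) (gs : list prf)
| PPrec (f g : prf)
| PMu (f : prf).

Inductive peval : prf -> list nat -> nat -> Prop :=
| ev_zero v : peval PZero v 0
| ev_succ x v : peval PSucc (x :: v) x.+1
| ev_proj i v : (i < length v)%coq_nat -> peval (PProj i) v (List.nth i v 0)
| ev_comp f gs v ys z :
    Forall2 (fun g y => peval g v y) gs ys -> peval f ys z ->
    peval (PComp f gs) v z
| ev_prec0 f g v z : peval f v z -> peval (PPrec f g) (0 :: v) z
| ev_precS f g n v y z :
    peval (PPrec f g) (n :: v) y -> peval g (n :: y :: v) z ->
    peval (PPrec f g) (n.+1 :: v) z
| ev_mu f v n :
    peval f (n :: v) 0 ->
    (forall m, (m < n)%N -> exists k, k <> 0 /\ peval f (m :: v) k) ->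
    peval (PMu f) v n.

Definition recursive_rel2 (Rel : nat -> nat -> Prop) : Prop :=
  exists p : prf, forall a b, exists k, peval p (a :: b :: nil) k /\ (Rel a b <-> k = 0).

Definition cpair (x y : nat) : nat := ((x + y) * (x + y).+1) %/ 2 + y.
Fixpoint seq_code (l : seq nat) : nat :=
  match l with nil => 0 | x :: l' => (cpair x (seq_code l')).+1 end.

(* the recursive presentation of Sigma^N: symbols coded by their rank *)
Definition sym_code (Sigma : finType) (a : Sigma) : nat := enum_rank a.

(* lightface Sigma^1_1 subsets of Sigma^N (projections of effectively
   closed subsets of Sigma^N x N^N) *)
Definition Sigma11 (Sigma : finType) (A : word Sigma -> Prop) : Prop :=
  exists Rel, recursive_rel2 Rel /\
    forall s, A s <-> exists y : nat -> nat, forall n,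
      Rel (seq_code (map (@sym_code Sigma) (mkseq s n))) (seq_code (mkseq y n)).

(* effectively Borel = lightface Delta^1_1 *)
Definition Delta11 (Sigma : finType) (A : word Sigma -> Prop) : Prop :=
  Sigma11 A /\ Sigma11 (fun s => ~ A s).

Definition tau_C (Sigma : finType) : (word Sigma -> Prop) -> Prop :=
  generated_open (fun U => exists w : seq Sigma, U = cyl w).

Definition tau_B (Sigma : finType) : (word Sigma -> Prop) -> Prop :=
  generated_open (@omega_regular Sigma).

Definition tau_A (Sigma : finType) : (word Sigma -> Prop) -> Prop :=
  generated_open (fun L => omega_regular L /\ closed_in (@tau_C Sigma) L).

Definition tau_delta (Sigma : finType) : (word Sigma -> Prop) -> Prop :=
  generated_open (@Delta11 Sigma).

Inductive topo_index := zC | zB | zA | zdelta.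

Definition tau (z : topo_index) (Sigma : finType) : (word Sigma -> Prop) -> Prop :=
  match z with
  | zC => @tau_C Sigma
  | zB => @tau_B Sigma
  | zA => @tau_A Sigma
  | zdelta => @tau_delta Sigma
  end.

(* Main.v *)
Require Import Defs.
From Stdlib Require Import Reals Lra List.
From mathcomp Require Import all_boot zify.
From mathcomp Require Import boolp.

(* Each of the four topologies on [X] is shown to be induced by an injection [x |-> (z_k x)_k] of [X] into the Baire space whose range is closed; the usual ultrametric of the Baire space then gives all the conclusions. The first coordinates are the letters of [x].

For [tau_A], a closed regular language contributes the length of the shortest prefix of [x] that leaves it.

For [tau_B], an automaton and a finite run [rho] contribute the least element of a cover of [X] by regular languages: the words with an accepting run through some extension of [rho] to a later final state, and the regular languages without accepting run through [rho]. In a limit point, following these extensions yields an accepting run. That this is a cover is Buchi's complementation theorem, obtained from a factorization of [x] into blocks with the same transition profile.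

For [tau_delta], a Delta11 set is given by two families of trees, of which exactly one has a branch for each word [x]. Let two players build a branch through the first tree and a branch through the second one, in alternation; the game ends at the first failure, so it is well-founded, and its value function [h_x] is the unique solution of local recursive conditions. So the sets [{x | h_x(m) = j}] are Delta11 and [x |-> h_x] has a closed graph, while [h_x] at the initial position decides whether [x] is in the set. *)

Set Implicit Arguments.
Unset Strict Implicit.
Unset Printing Implicit Defensive.

Delimit Scope R_scope with coqR.

Lemma least_nat (P : nat -> Prop) :
  (exists n, P n) -> exists n, P n /\ forall m, m < n -> ~ P m.
Proof.
move=> exP; have exb : exists n, `[< P n >] by case: exP => n /asboolP; exists n.
case: (ex_minnP exb) => n /asboolP Pn minn; exists n; split => // m lt_mn Pm.
by move/asboolP/minn: Pm; rewrite leqNgt lt_mn.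
Qed.

(** * Open sets of a generated topology *)

Section Generated.
Variables (X : Type) (F : (X -> Prop) -> Prop).
Notation T := (generated_open F).

Lemma generated_bigcup (I : Type) (U : I -> X -> Prop) :
  (forall i, T (U i)) -> T (fun x => exists i, U i x).
Proof.
move=> TU; pose G V := exists i, V = U i.
have TG : T (fun x => exists V, G V /\ V x).
  by apply: go_union => V [i ->].
apply: go_ext TG _ => x; split=> [[_ [[i ->] Uix]]|[i Uix]]; first by exists i.
by exists (U i); split=> //; exists i.
Qed.

Lemma generated_local (U : X -> Prop) :
  (forall x, U x -> exists V, [/\ T V, V x & forall y, V y -> U y]) -> T U.
Proof.
move=> locU; apply: (@go_ext _ _ (fun x => exists V : {V | T V /\ forall y, V y -> U y}, sval V x)).
  by apply: generated_bigcup => -[V []].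
move=> x; split=> [[[V [_ VU]] /= /VU]//|/locU [V [TV Vx VU]]].
by exists (exist _ V (conj TV VU)).
Qed.

Lemma generated_all (I : eqType) (s : seq I) (U : I -> X -> Prop) :
  (forall i, i \in s -> T (U i)) -> T (fun x => forall i, i \in s -> U i x).
Proof.
elim: s => [|i s IHs] TU; first by apply: go_ext (go_full F) _.
have TUi := TU i (mem_head i s).
have TUs : T (fun x => forall j, j \in s -> U j x).
  by apply: IHs => j js; apply: TU; rewrite inE js orbT.
apply: go_ext (go_inter TUi TUs) _ => x; split=> [[Ui Us] j|Us].
  by rewrite inE => /orP[/eqP->|/Us].
by split=> [|j js]; apply: Us; rewrite inE ?eqxx ?js ?orbT.
Qed.

End Generated.

(** * Embeddings into the Baire space with closed range *)

Section Embedding.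
Variables (X : Type) (F : (X -> Prop) -> Prop) (x0 : X) (Z : nat -> X -> nat).
Notation T := (generated_open F).
Let agree n x y := forall k, k < n -> Z k x = Z k y.

Hypothesis Z_inj : forall x y, (forall k, Z k x = Z k y) -> x = y.
Hypothesis Z_open : forall k j, T (fun x => Z k x = j).
Hypothesis Z_closed : forall s : nat -> nat,
  (forall n, exists x, forall k, k < n -> Z k x = s k) ->
  exists x, forall k, Z k x = s k.
Hypothesis Z_fine : forall U x, F U -> U x ->
  exists n, forall y, agree n x y -> U y.

Lemma embedding_ball_open n x : T (agree n x).
Proof.
apply: (@go_ext _ _ (fun y => forall k, k \in iota 0 n -> Z k y = Z k x)).
  by apply: generated_all => k _; apply: Z_open.
move=> y; split=> H k kn; rewrite H //; first by rewrite mem_iota.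
by move: kn; rewrite mem_iota.
Qed.

Lemma embedding_ball_closed n x : closed_in T (agree n x).
Proof.
apply: generated_local => y /existsNP [k /not_implyP [kn neq]].
exists (fun y' => Z k y' = Z k y); split=> // y' Zy' /(_ k kn) Zxy'.
by apply: neq; rewrite Zxy' Zy'.
Qed.

Lemma embedding_fine U x : T U -> U x ->
  exists n, forall y, agree n x y -> U y.
Proof.
move=> TU; elim: TU x => {U} [U FU x Ux||U V _ IU _ IV x [Ux Vx]|G _ IG x [U [GU Ux]]|U V _ IU UV x Vx].
- exact: Z_fine Ux.
- by exists 0.
- have [[n nU] [m mV]] := (IU x Ux, IV x Vx).
  exists (maxn n m) => y xy; split; [apply: nU|apply: mV] => k kn.
    by apply: xy; rewrite leq_max kn.
  by apply: xy; rewrite leq_max kn orbT.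
- by have [n nU] := IG U GU x Ux; exists n => y /nU; exists U.
- by have /UV/IU [n nU] := Vx; exists n => y /nU/UV.
Qed.

Lemma embedding_zero_dimensional : zero_dimensional T.
Proof.
move=> U x TU Ux; have [n nU] := embedding_fine TU Ux.
exists (agree n x); split; first exact: embedding_ball_open.
by split; first exact: embedding_ball_closed.
Qed.

(** The usual ultrametric: [1 / (n + 1)] for the first coordinate [n] at which the points differ;
    [Z_inj] provides such a coordinate. *)
Lemma embedding_dist : exists d : X -> X -> R, forall x y,
  (x = y /\ d x y = 0%coqR) \/
  exists n, [/\ d x y = (/ INR n.+1)%coqR, agree n x y & Z n x <> Z n y].
Proof.
suff H xy : exists r : R, (xy.1 = xy.2 /\ r = 0%coqR) \/
  exists n, [/\ r = (/ INR n.+1)%coqR, agree n xy.1 xy.2 & Z n xy.1 <> Z n xy.2].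
  by have [d dP] := choice H; exists (fun x y => d (x, y)) => x y; apply: (dP (x, y)).
case: xy => x y /=; have [xy|neq_xy] := pselect (x = y); first by exists 0%coqR; left.
have [n [neqn eqn]] : exists n, Z n x <> Z n y /\ forall m, m < n -> ~ Z m x <> Z m y.
  by apply: least_nat; apply/existsNP => eqZ; apply/neq_xy/Z_inj.
exists (/ INR n.+1)%coqR; right; exists n; split => // k /eqn.
by move/contrapT.
Qed.

Lemma invS_lt m n : (/ INR m.+1 < / INR n.+1)%coqR <-> n < m.
Proof.
have pos k : (0 < INR k.+1)%coqR by apply: lt_0_INR; apply/ltP.
split=> [lt_mn|/ltP lt_nm]; last first.
  by apply: Rinv_lt_contravar; [apply: Rmult_lt_0_compat|apply: lt_INR; apply/ltP; rewrite ltnS; apply/ltP].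
rewrite ltnNge; apply/negP => /leP le_mn.
have : (/ INR n.+1 <= / INR m.+1)%coqR.
  by apply: Rinv_le_contravar => //; apply: le_INR; apply/leP; rewrite ltnS; apply/leP.
lra.
Qed.

Lemma invS_pos n : (0 < / INR n.+1)%coqR.
Proof. by apply/Rinv_0_lt_compat/lt_0_INR/ltP. Qed.

Lemma invS_small eps : (0 < eps)%coqR -> exists n, (/ INR n.+1 < eps)%coqR.
Proof.
move=> /archimed_cor1 [[|n] [lt_eps /ltP //]] _; by exists n.
Qed.

(** Completeness comes from the closed range, separability from the countability of the set of
    finite sequences of coordinates. *)
Lemma embedding_polish : polish T.
Proof.
have [d dP] := embedding_dist; exists d.
have d_ge0 x y : (0 <= d x y)%coqR.
  by case: (dP x y) => [[_ ->]|[n [-> _ _]]]; [lra|have := invS_pos n; lra].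
have d_lt n x y : (d x y < / INR n.+1)%coqR <-> agree n.+1 x y.
  case: (dP x y) => [[<- ->]|[m [-> eqm neqm]]].
    by split=> // _; apply: invS_pos.
  rewrite invS_lt; split=> [lt_nm k kn|eqn]; first exact: eqm (leq_trans kn lt_nm).
  by rewrite ltnNge; apply/negP => le_mn; apply: neqm; apply: eqn.
have d_xx x : d x x = 0%coqR by case: (dP x x) => [[]//|[n [_ _]]].
split; [split; [by []|split; [|split]]|split; [|split]].
- move=> x y; split=> [dxy|->//]; case: (dP x y) => [[]//|[n [dE _ _]]].
  by have := invS_pos n; lra.
- move=> x y; case: (dP x y) => [[-> //]|[n [-> eqn neqn]]].
  case: (dP y x) => [[yx]|[m [-> eqm neqm]]]; first by case: neqn; rewrite yx.
  case: (ltngtP m n) => [lt|lt|-> //].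
    by case: neqm; rewrite eqn.
  by case: neqn; rewrite eqm.
- move=> x y z; case: (dP x z) => [[_ ->]|[n [-> eqn neqn]]].
    by have [] := (d_ge0 x y, d_ge0 y z); lra.
  apply: Rnot_lt_le => lt_d; apply: neqn.
  have [ge1 ge2] := (d_ge0 x y, d_ge0 y z).
  have /d_lt xy : (d x y < / INR n.+1)%coqR by lra.
  have /d_lt yz : (d y z < / INR n.+1)%coqR by lra.
  by rewrite xy // yz.
- move=> u cau.
  have /choice [N NP] n : exists N, forall i j, N <= i -> N <= j -> agree n.+1 (u i) (u j).
    have [N NP] := cau _ (invS_pos n); exists N => i j Ni Nj; apply/d_lt; exact: NP.
  have [l lP] : exists l, forall k, Z k l = Z k (u (N k)).
    apply: Z_closed => n; exists (u (\max_(k < n) N k)) => k kn.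
    apply: (NP k) => //; exact: (leq_bigmax (Ordinal kn)).
  exists l => eps /invS_small [n lt_n].
  exists (\max_(k < n.+1) N k) => m le_m; apply: Rlt_trans lt_n; apply/d_lt => k kn.
  rewrite lP; apply: (NP k) => //; apply: leq_trans le_m.
  exact: (leq_bigmax (Ordinal kn)).
(* One point for each finite sequence of values that some point realises; [x0] stands in for the
   other sequences. *)
- have /choice [D DP] (t : seq nat) : exists x,
      (exists y, forall k, k < size t -> Z k y = nth 0 t k) ->
      forall k, k < size t -> Z k x = nth 0 t k.
    have [[y yP]|ny] := pselect (exists y, forall k, k < size t -> Z k y = nth 0 t k).
      by exists y.
    by exists x0.
  exists (fun n => D (odflt [::] (unpickle n))) => x eps /invS_small [n lt_n].
  exists (pickle (mkseq (Z ^~ x) n.+1)); rewrite pickleK /=.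
  apply: Rlt_trans lt_n; apply/d_lt => k kn.
  rewrite DP ?size_mkseq ?nth_mkseq //; exists x => j jn; by rewrite nth_mkseq.
- move=> U; split=> [TU x /(embedding_fine TU) [n nU]|oU].
    exists (/ INR n.+1)%coqR; split; first exact: invS_pos.
    by move=> y /d_lt xy; apply: nU => k kn; apply: xy; apply: ltnW.
  apply: generated_local => x /oU [eps [/invS_small [n lt_n] epsU]].
  exists (agree n.+1 x); split=> [||y /d_lt xy]; first exact: embedding_ball_open.
    by [].
  by apply: epsU; lra.
Qed.

End Embedding.

Lemma polish_zero_dimensional (X : Type) (F : (X -> Prop) -> Prop) (x0 : X)
    (K : countType) (z : K -> X -> nat) :
  (forall x y, (forall k, z k x = z k y) -> x = y) ->
  (forall k j, generated_open F (fun x => z k x = j)) ->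
  (forall s : K -> nat,
    (forall l : seq K, exists x, forall k, k \in l -> z k x = s k) ->
    exists x, forall k, z k x = s k) ->
  (forall U x, F U -> U x ->
    exists l : seq K, forall y, (forall k, k \in l -> z k y = z k x) -> U y) ->
  polish (generated_open F) /\ zero_dimensional (generated_open F).
Proof.
move=> z_inj z_open z_closed z_fine.
(* Numbers that code no key get the constant coordinate [0]. *)
pose Z (n : nat) x := oapp (z ^~ x) 0 (pickle_inv n).
have ZE k x : Z (pickle k) x = z k x by rewrite /Z pickleK_inv.
have Z_inj x y : (forall k, Z k x = Z k y) -> x = y.
  by move=> eqZ; apply: z_inj => k; rewrite -!ZE.
have Z_open k j : generated_open F (fun x => Z k x = j).
  rewrite /Z; case: pickle_inv => [i|] /=; first exact: z_open.
  apply: generated_local => x jx; exists (fun=> True); split=> //; exact: go_full.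
have Z_closed (s : nat -> nat) :
    (forall n, exists x, forall k, k < n -> Z k x = s k) ->
    exists x, forall k, Z k x = s k.
  move=> sP; have [l|x xP] := z_closed (s \o pickle).
    have [x xP] := sP (\max_(k <- l) (pickle k).+1).
    exists x => k kl; rewrite -ZE xP //.
    by rewrite (big_rem k) //= leq_max leqnn.
  exists x => n; rewrite /Z; case E : (pickle_inv n) => [k|] /=.
    by rewrite xP /=; congr s; have := @pickle_invK K n; rewrite E.
  by have [y /(_ n (leqnn _)) <-] := sP n.+1; rewrite /Z E.
have Z_fine U x : F U -> U x ->
    exists n, forall y, (forall k, k < n -> Z k x = Z k y) -> U y.
  move=> FU Ux; have [l lU] := z_fine U x FU Ux.
  exists (\max_(k <- l) (pickle k).+1) => y xy; apply: lU => k kl.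
  by rewrite -!ZE xy // (big_rem k) //= leq_max leqnn.
split; first exact: embedding_polish Z_inj Z_open Z_closed Z_fine.
exact: embedding_zero_dimensional Z_open Z_fine.
Qed.

(** * Omega-regular languages *)

Lemma mkseq_eqP (T : Type) (x y : nat -> T) n :
  mkseq x n = mkseq y n <-> forall k, k < n -> x k = y k.
Proof.
split=> [eq_xy k kn|eq_xy].
  by rewrite -(nth_mkseq (x 0) x kn) eq_xy nth_mkseq.
by apply/eq_in_map => k; rewrite mem_iota => /andP[_ /eq_xy].
Qed.

Lemma cylE (Sigma : Type) (x y : word Sigma) n :
  cyl (mkseq x n) y <-> forall k, k < n -> x k = y k.
Proof.
rewrite /cyl size_mkseq mkseq_eqP; by split=> H k /H.
Qed.

(** * Cantor-open sets described by prefixes *)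

Section Cantor.
Variable Sigma : finType.

Lemma tau_CP (U : word Sigma -> Prop) : tau_C U <->
  forall x, U x -> exists n, forall y, (forall k, k < n -> x k = y k) -> U y.
Proof.
split=> [|locU].
  elim=> {U} [U [w ->] x <-||U V _ IU _ IV x [Ux Vx]|G _ IG x [U [GU Ux]]|U V _ IU UV x Vx].
  - by exists (size w) => y /cylE; rewrite /cyl size_mkseq.
  - by exists 0.
  - have [[n nU] [m mV]] := (IU x Ux, IV x Vx).
    exists (maxn n m) => y xy; split; [apply: nU|apply: mV] => k kn.
      by apply: xy; rewrite leq_max kn.
    by apply: xy; rewrite leq_max kn orbT.
  - by have [n nU] := IG U GU x Ux; exists n => y /nU; exists U.
  - by have /UV/IU [n nU] := Vx; exists n => y /nU/UV.
apply: generated_local => x /locU [n nU]; exists (cyl (mkseq x n)); split.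
- by apply: go_base; exists (mkseq x n).
- exact/cylE.
- by move=> y /cylE/nU.
Qed.

Lemma tau_C_prefix n (U : word Sigma -> Prop) :
  (forall x y, (forall k, k < n -> x k = y k) -> U x -> U y) -> tau_C U.
Proof. by move=> nU; apply/tau_CP => x Ux; exists n => y xy; apply: nU Ux. Qed.

Lemma tau_C_closed_prefix n (U : word Sigma -> Prop) :
  (forall x y, (forall k, k < n -> x k = y k) -> U x -> U y) ->
  closed_in (@tau_C Sigma) U.
Proof.
move=> nU; apply: (@tau_C_prefix n) => x y xy nUx Uy; apply: nUx.
by apply: nU Uy => k /xy.
Qed.

End Cantor.

(** * Automata with constraints on an initial part of the run *)

Section Automata.
Variable Sigma : finType.
Implicit Types (A : buchi Sigma) (x y : word Sigma).

(* The second component of a state counts the letters read, up to [N]. *)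
Definition timed A N (P : nat -> Sigma -> bstate A -> bool) : buchi Sigma :=
  @Buchi Sigma (bstate A * 'I_N.+1)%type
    [pred p | binit p.1 & p.2 == ord0] [pred p | bfinal p.1]
    (fun p s q => [&& btrans p.1 s q.1, val q.2 == minn p.2.+1 N &
                      (p.2 < N) ==> P p.2 s p.1]).

Lemma timedP A N (P : nat -> Sigma -> bstate A -> bool) x :
  buchi_lang (timed N P) x <->
  exists r, [/\ is_run x r, accepting_run r & forall t, t < N -> P t (x t) (r t)].
Proof.
split=> [[r [[/andP[init0 /eqP r0] rT] rF]]|[r [[init0 rT] rF rP]]].
  have rE t : val (r t).2 = minn t N.
    elim: t => [|t IHt]; first by rewrite r0 min0n.
    have /and3P[_ /eqP -> _] := rT t; rewrite IHt; lia.
  exists (fun t => (r t).1); split=> [||t tN]; first split=> // t.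
  - by have /and3P[] := rT t.
  - exact: rF.
  - have /and3P[_ _] := rT t; rewrite rE.
    by rewrite (minn_idPl (ltnW tN)) tN.
exists (fun t => (r t, inord (minn t N))).
have rE t : (inord (minn t N) : 'I_N.+1) = minn t N :> nat.
  by rewrite inordK // ltnS geq_minr.
split; last exact: rF.
split=> [|t] /=.
  by rewrite init0 /=; apply/eqP/val_inj; rewrite /= rE min0n.
rewrite !rE; apply/and3P; split; first exact: rT.
  by apply/eqP; lia.
apply/implyP => tN; have tN' : t < N by lia.
by rewrite (minn_idPl (ltnW tN')); apply: rP.
Qed.

Definition one_state : buchi Sigma :=
  @Buchi Sigma unit predT predT (fun _ _ _ => true).

Lemma omega_regular_letter m a : @omega_regular Sigma (fun x => x m = a).
Proof.
exists (@timed one_state m.+1 (fun t s _ => (t == m) ==> (s == a))) => x.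
rewrite timedP; split=> [<-|[r [_ _ /(_ m (leqnn _))]]].
  exists (fun=> tt); split=> [//|n|t _]; first by exists n.
  by apply/implyP => /eqP ->.
by rewrite eqxx => /eqP.
Qed.

Definition extends A (rho : seq (bstate A)) (r : nat -> bstate A) :=
  forall t, t < size rho -> r t = nth (r t) rho t.

Definition lang_from A (rho : seq (bstate A)) : word Sigma -> Prop :=
  fun x => exists r, [/\ is_run x r, accepting_run r & extends rho r].

Lemma lang_from_nil A x : lang_from (@nil (bstate A)) x <-> buchi_lang A x.
Proof. by split=> [[r [? ? _]]|[r []]]; exists r. Qed.

Lemma omega_regular_from A (rho : seq (bstate A)) : omega_regular (lang_from rho).
Proof.
exists (@timed A (size rho) (fun t _ q => q == nth q rho t)) => x.
by rewrite timedP; split=> -[r [rT rF rP]]; exists r; split=> // t /rP /eqP.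
Qed.

End Automata.

(** * Factorization of an infinite word by a finite deterministic transition system *)

Section Factorization.
Variables (Sigma : finType) (M : finType) (m0 : M) (step : M -> Sigma -> M).
Implicit Types (x y : word Sigma).

Definition dfa_run x i n : M := iteri n (fun t m => step m (x (i + t))) m0.

Lemma dfa_run_merge x i j k k' : i <= k -> j <= k -> k <= k' ->
  dfa_run x i (k - i) = dfa_run x j (k - j) ->
  dfa_run x i (k' - i) = dfa_run x j (k' - j).
Proof.
move=> ik jk kk' eq_k; rewrite -(subnKC kk'); elim: (k' - k) => [|d IHd].
  by rewrite addn0.
have -> : k + d.+1 - i = (k + d - i).+1 by lia.
have -> : k + d.+1 - j = (k + d - j).+1 by lia.
rewrite /dfa_run /= -!/(dfa_run _ _ _) IHd; congr (step _ (x _)); lia.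
Qed.

Definition cut_at x (g : nat -> nat) (c : nat -> M) :=
  [/\ g 0 = 0, forall i, g i < g i.+1 &
      forall i, dfa_run x (g i) (g i.+1 - g i) = c i].

Lemma pigeonhole_nat (P : nat -> Prop) (c : nat -> M) :
  (forall m, exists j, m <= j /\ P j) ->
  exists e, forall m, exists j, [/\ m <= j, P j & c j = e].
Proof.
move=> infP; apply: contrapT => /forallNP noe.
have /choice [b bP] e : exists m, forall j, m <= j -> P j -> c j <> e.
  have /existsNP [m /forallNP mP] := noe e.
  by exists m => j mj Pj ce; apply: (mP j).
have [j [mj Pj]] := infP (\max_e b e).
by apply: (bP (c j) j) => //; apply: leq_trans mj; apply: leq_bigmax.
Qed.

Lemma increasing_leq (g : nat -> nat) :
  (forall i, g i < g i.+1) -> forall i j, i <= j -> g i <= g j.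
Proof.
move=> g_lt i j ij; rewrite -(subnKC ij); elim: (j - i) => [|d IHd].
  by rewrite addn0.
by rewrite addnS; apply: leq_trans IHd (ltnW (g_lt _)).
Qed.

(** Otherwise each position [i] has a bound [b i] such that no run started beyond it ever meets the
    run from [i]. Jumping past these bounds gives [#|M| + 1] positions whose runs are in pairwise
    distinct states at a common time, which is too many. *)
Lemma infinitely_merging x : exists i, forall m, exists j,
  m <= j /\ exists k, [/\ i <= k, j <= k & dfa_run x i (k - i) = dfa_run x j (k - j)].
Proof.
apply: contrapT => /forallNP no.
have /choice [b bP] i : exists m, forall j k, m <= j -> i <= k -> j <= k ->
    dfa_run x i (k - i) <> dfa_run x j (k - j).
  have /existsNP [m /forallNP mP] := no i.
  by exists m => j k mj ik jk eqk; apply: (mP j); split=> //; exists k.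
pose f n := n.+1 + \max_(u < n.+1) b u.
pose i_ t := iter t f 0.
have i_lt t : i_ t < i_ t.+1 by rewrite /i_ iterS /f; lia.
have i_le := increasing_leq i_lt.
have b_le s t : s < t -> b (i_ s) <= i_ t.
  move=> /i_le; apply: leq_trans; rewrite [i_ s.+1]iterS -/(i_ s) /f.
  by apply: leq_trans (leq_addl _ _); apply: (@leq_bigmax 'I_(i_ s).+1 (fun u => b u) ord_max).
pose k := i_ #|M|.+1.
pose F (s : 'I_#|M|.+1) := dfa_run x (i_ s) (k - i_ s).
have injF : injective F.
  move=> s t; rewrite /F => eqst; apply: val_inj => /=.
  have [sk tk] : i_ s <= k /\ i_ t <= k by split; apply: i_le; exact: ltnW.
  case: (ltngtP s t) => // lt.
    by case: (bP (i_ s) (i_ t) k) => //; apply: b_le.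
  by case: (bP (i_ t) (i_ s) k) => //; apply: b_le.
by have := leq_card F injF; rewrite card_ord ltnn.
Qed.

(** Merging with the run from [i] replaces Ramsey's theorem. That run is in state [e] at infinitely
    many positions merging with it; a next cut chosen among these, past the meeting point, closes a
    block with state [e]. The first block starts at [0], which may not merge with [i], hence its own
    state [a]. *)
Lemma factorization x : exists a e g, cut_at x g (fun i => if i is 0 then a else e).
Proof.
have [i iP] := infinitely_merging x.
have [e eP] := pigeonhole_nat (fun j => dfa_run x i (j - i)) iP.
(* The last clause is conditional because [nxt] is defined at every [n]; all cuts after [0] do merge
   with [i]. *)
have /choice [nxt nxtP] n : exists j, n < j /\
    (exists k, [/\ i <= k, j <= k & dfa_run x i (k - i) = dfa_run x j (k - j)]) /\
    ((exists k, [/\ i <= k, n <= k & dfa_run x i (k - i) = dfa_run x n (k - n)]) ->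
      dfa_run x n (j - n) = e).
  have [[k [ik nk eqk]]|no] := pselect (exists k, [/\ i <= k, n <= k &
      dfa_run x i (k - i) = dfa_run x n (k - n)]).
    have [j [kj mrg je]] := eP (maxn k n.+1).
    exists j; split; first by lia.
    split=> // _; rewrite -je; symmetry; apply: dfa_run_merge eqk => //; lia.
  have [j [nj mrg je]] := eP n.+1.
  by exists j.
pose g t := iter t nxt 0.
exists (dfa_run x 0 (g 1)), e, g; split=> // [t|[|t]].
- by rewrite /g iterS; case: (nxtP (iter t nxt 0)).
- by rewrite subn0.
- rewrite [g t.+2]iterS -/(g t.+1).
  have [_ [_ ->//]] := nxtP (g t.+1).
  by rewrite [g t.+1]iterS -/(g t); have [_ []] := nxtP (g t).
Qed.

Lemma segment (g : nat -> nat) : g 0 = 0 -> (forall i, g i < g i.+1) ->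
  exists seg : nat -> nat, (forall t, g (seg t) <= t < g (seg t).+1) /\
    forall i t, g i <= t < g i.+1 -> seg t = i.
Proof.
move=> g0 g_lt; have g_le := increasing_leq g_lt.
have /choice [seg segP] t : exists i, g i <= t < g i.+1.
  elim: t => [|t [i /andP[it ti]]].
    by exists 0; rewrite g0 /= -{1}g0.
  have [lt|ge] := ltnP t.+1 (g i.+1); first by exists i; lia.
  exists i.+1; have := g_lt i.+1; lia.
exists seg; split=> // i t /andP[it ti].
have /andP[st ts] := segP t.
case: (ltngtP (seg t) i) => // lt; have := g_le _ _ lt; lia.
Qed.

(* Guesses the cuts: the last flag of a state marks the positions just after a cut, the first one is raised by the first cut. *)
Definition cut_automaton (a e : M) : buchi Sigma :=
  @Buchi Sigma (bool * M * bool)%type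
    [pred p | p == (false, m0, false)] [pred p | p.2]
    (fun p s q => if q.2 then
         (step p.1.2 s == if p.1.1 then e else a) && (q.1 == (true, m0))
       else q.1 == (p.1.1, step p.1.2 s)).

Lemma infinite_enum (P : pred nat) : ~~ P 0 ->
  (forall m, exists n, m <= n /\ P n) ->
  exists g : nat -> nat, [/\ g 0 = 0, forall i, g i < g i.+1,
    forall i, P (g i.+1) & forall i t, g i < t < g i.+1 -> ~~ P t].
Proof.
move=> P0 infP.
have /choice [nxt nxtP] n : exists j, [/\ n < j, P j & forall t, n < t < j -> ~~ P t].
  have exP : exists j, (n < j) && P j.
    by have [j [nj Pj]] := infP n.+1; exists j; apply/andP.
  case: (ex_minnP exP) => j /andP[nj Pj] jmin; exists j; split=> // t /andP[nt tj].
  by apply/negP => Pt; have := jmin t; rewrite nt Pt => /(_ isT); rewrite leqNgt tj.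
by exists (fun t => iter t nxt 0); split=> // [i|i|i]; rewrite iterS;
  case: (nxtP (iter i nxt 0)).
Qed.

(** The times at which an accepting run raises its last flag are the cuts; between them the
    automaton simulates [dfa_run] from [m0]. *)
Lemma cut_automatonP a e x : buchi_lang (cut_automaton a e) x <->
  exists g, cut_at x g (fun i => if i is 0 then a else e).
Proof.
split=> [[r [[/eqP r0 rT] rF]]|[g [g0 g_lt gc]]].
  have [||g [g0 g_lt gP gN]] := @infinite_enum (fun t => (r t).2).
  - by rewrite r0.
  - by move=> m; have [n [mn Fn]] := rF m; exists n.
  exists g; have rg i : (r (g i)).1 = (0 < i, m0).
    case: i => [|i]; first by rewrite g0 r0.
    have := gP i; have := g_lt i; case: (g i.+1) => // t _ Pt.
    by have := rT t; rewrite /= Pt => /andP[_ /eqP].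
  have rE i n : g i + n < g i.+1 -> (r (g i + n)).1 = (0 < i, dfa_run x (g i) n).
    elim: n => [|n IHn] lt; first by rewrite addn0 rg.
    have := rT (g i + n); rewrite /= -addnS (negbTE (gN i _ _)); last by lia.
    by rewrite IHn ?[in X in X == _]surjective_pairing => [/eqP ->|] //; lia.
  split=> // i; have [n nE] : exists n, g i.+1 = (g i + n).+1.
    by exists (g i.+1 - g i).-1; have := g_lt i; lia.
  have := rT (g i + n); rewrite /= -nE gP => /andP[+ _].
  rewrite rE ?nE // -addnS addKn => /eqP /=.
  by case: i {nE} => [|i].
have [seg [segP segE]] := segment g0 g_lt.
(* The flag stays down at time [0], although [0] is a cut, as the initial state requires. *)
exists (fun t => (0 < seg t, dfa_run x (g (seg t)) (t - g (seg t)),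
                  (0 < seg t) && (t == g (seg t)))).
have seg0 : seg 0 = 0 by apply: segE; rewrite g0 /= -{1}g0.
split; last first.
  move=> m; exists (g m.+1); have segm : seg (g m.+1) = m.+1.
    by apply: segE; rewrite leqnn g_lt.
  rewrite /= segm eqxx; split=> //.
  elim: m {segm} => // m IHm; exact: leq_ltn_trans IHm (g_lt _).
split=> [|t] /=; first by rewrite seg0.
have /andP[st ts] := segP t.
have [lt|ge] := ltnP t.+1 (g (seg t).+1).
  have -> : seg t.+1 = seg t by apply: segE; lia.
  have -> : (t.+1 == g (seg t)) = false by lia.
  rewrite andbF; apply/eqP; congr (_, _); rewrite subSn // /dfa_run /=.
  by rewrite subnKC.
have Et : t.+1 = g (seg t).+1 by lia.
have -> : seg t.+1 = (seg t).+1 by apply: segE; rewrite Et leqnn g_lt.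
rewrite -Et eqxx subnn /= eqxx andbT.
have := gc (seg t); rewrite -Et subSn // /dfa_run /= subnKC // => ->.
by case: (seg t).
Qed.

End Factorization.

(** * Local form of Buchi complementation *)

Section Complement.
Variables (Sigma : finType) (A : buchi Sigma).
Notation Q := (bstate A).
Implicit Types (x y : word Sigma).

(** The profile of a finite word holds [(p, q, b)] when some path from [p] to [q] reads the word and
    [b] tells whether it meets a final state after its first state. Leaving out the first state
    makes consecutive blocks count disjoint sets of positions. *)
Definition profile0 : {set Q * Q * bool} := [set p | (p.1.1 == p.1.2) && ~~ p.2].

Definition profile_step (m : {set Q * Q * bool}) (s : Sigma) : {set Q * Q * bool} :=
  [set p | [exists q, exists b, [&& (p.1.1, q, b) \in m, btrans q s p.1.2 &
                                    p.2 == b || bfinal p.1.2]]].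

Notation profile := (dfa_run profile0 profile_step).

Lemma profileP x i n p q b : reflect
  (exists r : nat -> Q, [/\ r 0 = p, r n = q,
     forall t, t < n -> btrans (r t) (x (i + t)) (r t.+1) &
     b = has (fun t => bfinal (r t)) (iota 1 n)])
  ((p, q, b) \in profile x i n).
Proof.
elim: n q b => [|n IHn] q b.
  rewrite /dfa_run /= inE /=; apply: (iffP andP) => [[/eqP -> /negbTE ->]|].
    by exists (fun=> q).
  by move=> [r [-> -> _ ->]].
rewrite {1}/dfa_run /= -/(dfa_run _ _ _) inE /=.
have iotaE r : has (fun t => bfinal (r t)) (iota 1 n.+1) =
    has (fun t => @bfinal _ A (r t)) (iota 1 n) || bfinal (r n.+1).
  by rewrite -[in iota 1 n.+1](addn1 n) iotaD has_cat /= orbF.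
rewrite /= in iotaE.
apply: (iffP existsP) => [[q' /existsP [b' /and3P[/IHn [r [r0 rn rT rb]] Tq' /eqP ->]]]|].
  exists (fun t => if t <= n then r t else q); split=> //.
  - by rewrite ltnn.
  - move=> t; rewrite ltnS leq_eqVlt => /orP[/eqP ->|tn] /=; first by rewrite eqxx ltnn rn.
    by rewrite tn orbT rT.
  - rewrite iotaE ltnn rb; congr (_ || _); apply: eq_in_has => t; rewrite mem_iota.
    by case/andP=> _; rewrite addSn ltnS => ->.
move=> [r [r0 rn rT ->]].
exists (r n); apply/existsP; exists (has (fun t => bfinal (r t)) (iota 1 n)).
rewrite iotaE rn eqxx andbT -rn rT // andbT; apply/IHn; exists r; split=> // t tn.
by apply: rT; apply: ltnW.
Qed.

(** An accepting run on [x] is transferred block by block: equal profiles supply, over each block of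
    [y], a path with the same end states and the same record of final states. *)
Lemma cut_at_lang x y g g' c : cut_at profile0 profile_step x g c ->
  cut_at profile0 profile_step y g' c -> buchi_lang A x -> buchi_lang A y.
Proof.
move=> [g0 g_lt gc] [g'0 g'_lt g'c] [r [[init0 rT] rF]].
pose b i := has (fun t => bfinal (r (g i + t))) (iota 1 (g i.+1 - g i)).
have /choice [rho rhoP] i : exists rho : nat -> Q,
    [/\ rho 0 = r (g i), rho (g' i.+1 - g' i) = r (g i.+1),
     forall t, t < g' i.+1 - g' i -> btrans (rho t) (y (g' i + t)) (rho t.+1) &
     b i = has (fun t => bfinal (rho t)) (iota 1 (g' i.+1 - g' i))].
  apply/profileP; rewrite g'c -gc; apply/profileP.
  exists (fun t => r (g i + t)); split=> //; first by rewrite addn0.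
    by rewrite subnKC // ltnW.
  by move=> t _; rewrite addnS; apply: rT.
have [seg [segP segE]] := segment g'0 g'_lt.
pose r' t := rho (seg t) (t - g' (seg t)).
have r'E i t : t <= g' i.+1 - g' i -> r' (g' i + t) = rho i t.
  rewrite leq_eqVlt => /orP[/eqP ->|lt].
    have [_ -> _ _] := rhoP i; rewrite subnKC; last exact: ltnW.
    rewrite /r' (segE i.+1) ?leqnn ?g'_lt // subnn.
    by have [-> _ _ _] := rhoP i.+1.
  by rewrite /r' (segE i) ?addKn //; lia.
exists r'; split; first split.
- have := r'E 0 0 (leq0n _); rewrite g'0 => ->.
  by have [-> _ _ _] := rhoP 0; rewrite g0.
- move=> t; have /andP[st ts] := segP t.
  rewrite -(subnKC st) -addnS !r'E; try by lia.
  by have [_ _ H _] := rhoP (seg t); apply: H; lia.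
(* A block counts its right end and not its left end, so the final state at time [n] belongs to the
   block containing [n.-1]. *)
move=> m; have [n [mn Fn]] := rF (g m).+1.
have [seg1 [seg1P seg1E]] := segment g0 g_lt.
move: (seg1P n.-1); set i := seg1 n.-1 => /andP[sn ns].
have g_le := increasing_leq g_lt; have g'_le := increasing_leq g'_lt.
have mi : m <= i.
  by rewrite leqNgt; apply/negP => /g_le le_gm; lia.
have : b i.
  apply/hasP; exists (n - g i); last by rewrite subnKC //; lia.
  by rewrite mem_iota; lia.
have [_ _ _ ->] := rhoP i => /hasP [t]; rewrite mem_iota => /andP[t0 tl] Ft.
exists (g' i + t); have tl' : t <= g' i.+1 - g' i by rewrite add1n in tl.
rewrite r'E //.
split=> //; have ge_id j : j <= g' j by elim: j => // j IHj; apply: leq_ltn_trans IHj (g'_lt j).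
by have := ge_id i; lia.
Qed.

(** All words with a factorization of the same type [(a, e)] as [x] agree with [x] on membership,
    and [cut_automaton] recognises these words. *)
Lemma omega_regular_compl x : ~ buchi_lang A x ->
  exists B : buchi Sigma, buchi_lang B x /\ forall y, buchi_lang B y -> ~ buchi_lang A y.
Proof.
move=> nAx; have [a [e [g gP]]] := factorization profile0 profile_step x.
exists (cut_automaton profile0 profile_step a e); split.
  by apply/cut_automatonP; exists g.
by move=> y /cut_automatonP [g' g'P] Ay; apply: nAx; apply: cut_at_lang g'P gP Ay.
Qed.

End Complement.

(** * The Cantor, automatic and Buchi topologies *)

Section WordPolish.
Variables (Sigma : finType) (F : (word Sigma -> Prop) -> Prop).
Notation T := (generated_open F).
Implicit Types x y : word Sigma.

Hypothesis letter_open : forall m a, T (fun x => x m = a).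

Lemma tau_C_sub U : tau_C U -> T U.
Proof.
move/tau_CP => locU; apply: generated_local => x /locU [n nU].
exists (fun y => forall k, k \in iota 0 n -> y k = x k); split=> //.
  by apply: generated_all => k _; apply: letter_open.
by move=> y yP; apply: nU => k kn; rewrite yP // mem_iota.
Qed.

(** The letters join the family [z] as coordinates. They alone determine the limit point [x], so
    closedness only asks that [z] take the limit values at [x]. *)
Lemma word_polish (K : countType) (z : K -> word Sigma -> nat) :
  2 <= #|Sigma| ->
  (forall k j, T (fun x => z k x = j)) ->
  (forall x s, (forall n (l : seq K), exists y,
      (forall k, k < n -> y k = x k) /\ forall k, k \in l -> z k y = s k) ->
    forall k, z k x = s k) ->
  (forall U x, F U -> U x -> exists n (l : seq K), forall y,
      (forall k, k < n -> y k = x k) -> (forall k, k \in l -> z k y = z k x) ->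
      U y) ->
  polish T /\ zero_dimensional T.
Proof.
move=> card2 z_open z_closed z_fine.
have /card_gt0P [a _] : 0 < #|Sigma| by apply: ltnW.
pose Z (k : nat + K) x := match k with inl m => nat_of_ord (enum_rank (x m)) | inr k => z k x end.
have letter_inj (b c : Sigma) : enum_rank b = enum_rank c :> nat -> b = c.
  by move=> /val_inj /enum_rank_inj.
apply: (@polish_zero_dimensional _ F (fun=> a) _ Z).
- by move=> x y eqZ; apply/funext => m; apply: letter_inj; apply: (eqZ (inl m)).
- move=> [m|k] j /=; last exact: z_open.
  apply: generated_local => x xj; exists (fun y => y m = x m); split=> //.
  by move=> y ->.
- move=> s sP.
  have /choice [x xP] m : exists b : Sigma, enum_rank b = s (inl m) :> nat.
    by have [y /(_ _ (mem_head _ _)) <-] := sP [:: inl m]; exists (y m).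
  exists x => -[m|k] /=; first exact: xP.
  apply: (z_closed x (s \o inr)) => n l.
  have [y yP] := sP (map inl (iota 0 n) ++ map inr l).
  exists y; split=> [i i_n|i il]; last first.
    by apply: (yP (inr i)); rewrite mem_cat map_f ?orbT.
  apply: letter_inj; rewrite xP; apply: (yP (inl i)).
  by rewrite mem_cat map_f // mem_iota.
move=> U x FU Ux; have [n [l lU]] := z_fine U x FU Ux.
exists (map inl (iota 0 n) ++ map inr l) => y yP; apply: lU => k kP.
  by apply: letter_inj; apply: (yP (inl k)); rewrite mem_cat map_f // mem_iota.
by apply: (yP (inr k)); rewrite mem_cat map_f ?orbT.
Qed.

End WordPolish.

Lemma tau_C_polish (Sigma : finType) : 2 <= #|Sigma| ->
  polish (@tau_C Sigma) /\ zero_dimensional (@tau_C Sigma).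
Proof.
move=> card2; apply: (@word_polish _ _ _ void (fun _ _ => 0)) => //.
- by move=> m a; apply: (@tau_C_prefix _ m.+1) => x y xy <-; rewrite xy.
- move=> U x FU Ux; have /tau_CP/(_ x Ux) [n nU] : tau_C U by apply: go_base.
  by exists n, [::] => y yx _; apply: nU => k /yx.
Qed.

(** * Countable codes of automata *)

Section AutomatonCodes.
Variable Sigma : finType.

Definition acode := {n : nat & ({set 'I_n} * {set 'I_n} * {set 'I_n * Sigma * 'I_n})%type}.

Definition automaton_of (c : acode) : buchi Sigma :=
  @Buchi Sigma 'I_(tag c) (mem (tagged c).1.1) (mem (tagged c).1.2)
    (fun p s q => (p, s, q) \in (tagged c).2).

Lemma automaton_code (A : buchi Sigma) : exists c : acode,
  forall x, buchi_lang (automaton_of c) x <-> buchi_lang A x.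
Proof.
pose I := [set i : 'I_#|bstate A| | @binit _ A (enum_val i)].
pose E := [set i : 'I_#|bstate A| | @bfinal _ A (enum_val i)].
pose D := [set t : 'I_#|bstate A| * Sigma * 'I_#|bstate A| |
             @btrans _ A (enum_val t.1.1) t.1.2 (enum_val t.2)].
exists (existT _ #|bstate A| (I, E, D)) => x; split=> -[r [[r0 rT] rF]].
  exists (fun t => enum_val (r t)); split; first split.
  - by move: r0; rewrite /= inE.
  - by move=> t; have := rT t; rewrite /= inE.
  - by move=> m; have [n [mn]] := rF m; rewrite /= inE; exists n.
exists (fun t => enum_rank (r t)); split; first split.
- by rewrite /= inE enum_rankK.
- by move=> t; rewrite /= inE /= !enum_rankK.
- by move=> m; have [n [mn Fn]] := rF m; exists n; rewrite /= inE enum_rankK.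
Qed.

End AutomatonCodes.

Lemma tau_A_polish (Sigma : finType) : 2 <= #|Sigma| ->
  polish (@tau_A Sigma) /\ zero_dimensional (@tau_A Sigma).
Proof.
move=> card2; pose F (L : word Sigma -> Prop) := omega_regular L /\ closed_in (@tau_C Sigma) L.
have letter_open m a : generated_open F (fun x => x m = a).
  apply: go_base; split; first exact: omega_regular_letter.
  by apply: (@tau_C_closed_prefix _ m.+1) => x y xy <-; rewrite xy.
pose L (c : acode Sigma) := buchi_lang (automaton_of c).
pose closed c := closed_in (@tau_C Sigma) (L c).
pose agree n (x y : word Sigma) := forall k, k < n -> x k = y k.
have agree_sym n x y : agree n x y -> agree n y x by move=> xy k /xy.
have agree_trans n x y w : agree n x y -> agree n y w -> agree n x w.
  by move=> xy yw k kn; rewrite xy // yw.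
have agree_leq m n x y : m <= n -> agree n x y -> agree m x y.
  by move=> mn xy k km; apply: xy; apply: leq_trans mn.
(* Rank [0] is membership in [L c]; rank [n.+1] says that the shortest prefix of [x] without
   extension in [L c] has length [n]. Codes of languages that are not closed get [0] throughout. *)
pose is_rank c x r := ~ closed c /\ r = 0 \/ closed c /\ (L c x /\ r = 0 \/
  exists n, [/\ r = n.+1, forall y, agree n x y -> ~ L c y &
                forall m, m < n -> exists y, agree m x y /\ L c y]).
have /choice [f fP] (p : acode Sigma * word Sigma) : exists r, is_rank p.1 p.2 r.
  case: p => c x /=; have [cl|ncl] := pselect (closed c); last by exists 0; left.
  have [Lx|nLx] := pselect (L c x); first by exists 0; right; split=> //; left.
  have /tau_CP/(_ x nLx)/least_nat [n [nL minn]] := cl.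
  exists n.+1; right; split=> //; right; exists n; split=> // m /minn.
  by move=> /existsNP [y /not_implyP [xy /contrapT]]; exists y.
pose z c x := f (c, x); have {}fP c x : is_rank c x (z c x) by apply: (fP (c, x)).
(* A positive rank is settled by finitely many letters, so its level set is already Cantor-open. *)
have rank_prefix c x y n : z c x = n.+1 -> agree n x y -> z c y = n.+1.
  move=> zx xy; case: (fP c x) => [[_]|[cl]]; first by rewrite zx.
  rewrite zx => -[[]//|[_ [[<-] nL Lm]]].
  case: (fP c y) => [[]//|[_ [[Ly _]|[m [-> mL Lk]]]]]; first by case: (nL y).
  congr S; case: (ltngtP m n) => // [mn|nm].
    have [w [xw Lw]] := Lm m mn; case: (mL w) => //.
    by apply: agree_trans xw; apply: agree_sym; apply: agree_leq xy; apply: ltnW.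
  have [w [yw Lw]] := Lk n nm; case: (nL w) => //; exact: agree_trans yw.
apply: (@word_polish _ F letter_open _ z) => //.
- move=> c [|n]; last first.
    by apply: tau_C_sub => //; apply: (@tau_C_prefix _ n) => x y xy zx; apply: rank_prefix xy.
  apply: generated_local => x zx.
  case: (fP c x) => [[ncl _]|[cl]].
    exists (fun=> True); split=> //; first exact: go_full.
    by move=> y _; case: (fP c y) => [[]|[]].
  rewrite zx => -[[Lx _]|[? []//]].
  exists (L c); split=> // [|y Ly]; first by apply: go_base; split=> //; exists (automaton_of c).
  case: (fP c y) => [[]//|[_ [[]//|[n [_ /(_ y)]]]]].
  by case.
(* A limit value [n.+1] passes to [x] from a word sharing [n] letters with it. If the limit value is
   [0] and [L c] is closed, then [x] is in [L c], since otherwise words close to [x] would have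
   positive rank. *)
- move=> x s sP c; case E : (s c) => [|n]; last first.
    have [y [yx /(_ c (mem_head _ _))]] := sP n [:: c].
    by rewrite E => /rank_prefix; apply.
  case: (fP c x) => [[]//|[cl [[]//|[n [_ nL _]]]]].
  have [y [yx /(_ c (mem_head _ _))]] := sP n [:: c]; rewrite E => zy.
  case: (fP c y) => [[]//|[_ [[Ly _]|]]]; first by case: (nL y) => //; exact: agree_sym.
  by rewrite zy => -[? []].
- move=> U x [[A AP] clU] Ux; have [c cP] := automaton_code A.
  have LU y : L c y <-> U y by rewrite /L cP AP.
  have cl : closed c by apply: go_ext clU _ => y; rewrite LU.
  exists 0, [:: c] => y _ /(_ c (mem_head _ _)) zy; apply/LU.
  have zx : z c x = 0.
    by case: (fP c x) => [[]//|[_ [[]//|[n [_ /(_ x)]]]]]; case=> //; apply/LU.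
  case: (fP c y) => [[]//|[_ [[]//|[n []]]]]; by rewrite zy zx.
Qed.

(** * Coordinates for the Buchi topology *)

Section Buchi.
Variable Sigma : finType.

(* A code [c] of an automaton, together with a finite run [rho] of it, stands for the words with an accepting run through [rho]. *)
Let K := {c : acode Sigma & seq 'I_(tag c)}.
Let L (k : K) : word Sigma -> Prop := @lang_from Sigma (automaton_of (tag k)) (tagged k).

(** The added part [rcons e q] is nonempty and ends in a final state, so infinitely many advances
    produce infinitely many visits to final states. *)
Let advances (k j : K) := exists e q, @bfinal _ (automaton_of (tag k)) q /\
  j = existT _ (tag k) (tagged k ++ rcons e q).
Let good k j := advances k j \/ forall x, L j x -> ~ L k x.

Lemma advances_sub k j : advances k j -> forall x, L j x -> L k x.
Proof.
move=> [e [q [_ ->]]] x [r [/= rT rF rP]]; exists r; split=> // t tk.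
by have := rP t; rewrite nth_cat tk; apply; rewrite size_cat ltn_addr.
Qed.

(** A word in [L k] follows its run to a final state past the prescribed part; any other word lies
    in a regular language disjoint from [L k], by complementation. *)
Lemma buchi_good_cover k x : exists j, L j x /\ good k j.
Proof.
have [[r [rT rF rP]]|nLx] := pselect (L k x).
  case: k r rT rF rP => c rho /= r rT rF rP.
  have [n [rho_n Fn]] := rF (size rho).
  exists (existT _ c (mkseq r n.+1)); split.
    by exists r; split=> // t; rewrite size_mkseq => tn; rewrite nth_mkseq.
  left; exists (mkseq (fun t => r (size rho + t)) (n - size rho)), (r n); split=> //=.
  congr existT; apply: (@eq_from_nth _ (r 0)) => [|i].
    by rewrite size_cat size_rcons !size_mkseq; lia.
  rewrite size_mkseq => i_n; rewrite nth_mkseq // nth_cat nth_rcons size_mkseq.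
  case: ltnP => [lt|ge]; first by rewrite rP //; apply: set_nth_default.
  case: ltngtP => [lt|gt|eq_in]; first by rewrite nth_mkseq // subnKC.
    lia.
  by congr r; lia.
have [A AP] := @omega_regular_from _ (automaton_of (tag k)) (tagged k).
have [B [Bx Bdisj]] : exists B, buchi_lang B x /\ forall y, buchi_lang B y -> ~ buchi_lang A y.
  by apply: omega_regular_compl; rewrite -AP.
have [c cP] := automaton_code B.
exists (existT _ c [::]); split; first by apply/lang_from_nil; rewrite cP.
right=> y /lang_from_nil /=; rewrite cP => By /AP; exact: Bdisj.
Qed.

(** Iterating [J] from [k] yields longer and longer finite runs [rho_ t], whose union [r] meets
    infinitely many final states. Each transition of [r] on [x] is verified on a run over a word [y]
    that shares enough letters with [x]. *)
Lemma buchi_limit_run (x : word Sigma) (J : K -> K) (k : K) :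
  (forall n j, exists y, [/\ forall i, i < n -> y i = x i & L (J j) y]) ->
  (forall j, advances j (J j) -> advances (J j) (J (J j))) ->
  advances k (J k) -> L k x.
Proof.
case: k => c rho Jx Jadv adv0.
have /choice [nxt nxtP] rho1 : exists rho2, advances (existT _ c rho1) (J (existT _ c rho1)) ->
    [/\ J (existT _ c rho1) = existT _ c rho2, advances (existT _ c rho2) (J (existT _ c rho2)) &
     exists e q, @bfinal _ (automaton_of c) q /\ rho2 = rho1 ++ rcons e q].
  have [adv|nadv] := pselect (advances (existT _ c rho1) (J (existT _ c rho1))); last by exists [::].
  have [e [q [Fq Jk]]] := adv; exists (rho1 ++ rcons e q) => _; split=> //.
    by have := Jadv _ adv; rewrite Jk.
  by exists e, q.
pose rho_ t := iter t nxt rho.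
have advt t : advances (existT _ c (rho_ t)) (J (existT _ c (rho_ t))).
  by elim: t => // t IHt; case: (nxtP _ IHt).
have Jt t : J (existT _ c (rho_ t)) = existT _ c (rho_ t.+1) by case: (nxtP _ (advt t)).
have rhoS t : exists e q, @bfinal _ (automaton_of c) q /\ rho_ t.+1 = rho_ t ++ rcons e q.
  by case: (nxtP _ (advt t)).
have [_ [q0 _]] := rhoS 0.
have size_rho t : t <= size (rho_ t).
  elim: t => // t IHt; have [e [q [_ ->]]] := rhoS t.
  rewrite size_cat size_rcons; lia.
have nth_rho t t' i : t <= t' -> i < size (rho_ t) -> nth q0 (rho_ t') i = nth q0 (rho_ t) i.
  move=> tt' it; rewrite -(subnKC tt'); elim: (t' - t) => [|d IHd]; first by rewrite addn0.
  have [e [q [_ E]]] := rhoS (t + d); rewrite addnS E nth_cat IHd.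
  case: ltnP => // ge.
  have : size (rho_ t) <= size (rho_ (t + d)).
    elim: (d) => [|d' IH]; first by rewrite addn0.
    have [e' [q' [_ E']]] := rhoS (t + d'); rewrite addnS E' size_cat; lia.
  by move=> /(leq_trans it); rewrite ltnNge ge.
pose r t : bstate (automaton_of c) := nth q0 (rho_ t.+1) t.
have rE t i : i < size (rho_ t) -> nth q0 (rho_ t) i = r i.
  move=> it; have [ti|it'] := leqP t i.+1; first by rewrite /r (nth_rho _ _ _ ti).
  by rewrite (nth_rho i.+1) // ltnW.
have run_near n : exists y ry, [/\ forall i, i < n -> y i = x i,
    @is_run _ (automaton_of c) y ry & forall i, i < n -> ry i = r i].
  have := Jx n (existT _ c (rho_ n)); rewrite Jt => -[y [yx [ry [ryT _ ryP]]]].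
  exists y, ry; split=> // i i_n.
  have lt : i < size (rho_ n.+1) by apply: leq_trans (size_rho _); apply: ltnW.
  rewrite ryP // -(rE n.+1) //; exact: set_nth_default.
exists r; split; first split.
- by have [y [ry [_ [ry0 _] <-]]] := run_near 1.
- move=> t; have [y [ry [yx [_ ryT] ryr]]] := run_near t.+2.
  by rewrite -yx // -!ryr.
- move=> m; have [e [q [Fq E]]] := rhoS m.
  exists (size (rho_ m) + size e); split; first exact: leq_trans (size_rho m) (leq_addr _ _).
  have lt : size (rho_ m) + size e < size (rho_ m.+1) by rewrite E size_cat size_rcons ltn_add2l.
  by rewrite -(rE m.+1) // E nth_cat ltnNge leq_addr /= addKn nth_rcons ltnn eqxx.
- by move=> t trho; rewrite -(rE 0) //; apply: set_nth_default.
Qed.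

Lemma tau_B_polish : 2 <= #|Sigma| ->
  polish (@tau_B Sigma) /\ zero_dimensional (@tau_B Sigma).
Proof.
move=> card2.
have L_open k : tau_B (L k) by apply: go_base; apply: omega_regular_from.
have L_closed k : tau_B (fun x => ~ L k x).
  apply: generated_local => x nLx; have [j [Ljx [adv|disj]]] := buchi_good_cover k x.
    by case: nLx; apply: advances_sub adv _ Ljx.
  by exists (L j); split=> //; apply: L_open.
(* The candidates are ordered by [pickle]; only finitely many precede a given one, which keeps the
   choice of the least one an open condition. *)
pose least k x j := [/\ L j x, good k j &
  forall i, good k i -> pickle i < pickle j -> ~ L i x].
have /choice [f fP] (p : K * word Sigma) : exists j, least p.1 p.2 j.
  case: p => k x /=; have [j jP] := buchi_good_cover k x.
  have [n [[i [<- [Lix ki]]] imin]] : exists n,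
      (exists j, pickle j = n /\ L j x /\ good k j) /\
      forall m, m < n -> ~ exists j, pickle j = m /\ L j x /\ good k j.
    by apply: least_nat; exists (pickle j), j.
  exists i; split=> // i' ki' lt Li'x; apply: (imin _ lt); by exists i'.
pose J k x := f (k, x); have {}fP k x : least k x (J k x) by apply: (fP (k, x)).
have least_uniq k x i j : least k x i -> least k x j -> i = j.
  move=> [Li ki imin] [Lj kj jmin]; apply: (pcan_inj pickleK).
  by case: (ltngtP (pickle i) (pickle j)) => // [/(jmin _ ki)|/(imin _ kj)].
apply: (@word_polish _ _ _ K (fun k x => pickle (J k x))) => //.
- by move=> m a; apply: go_base; apply: omega_regular_letter.
- move=> k p; apply: generated_local => x <-; have [Lx kJ Jmin] := fP k x.
  exists (fun y => L (J k x) y /\ forall n, n \in iota 0 (pickle (J k x)) ->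
    forall i, pickle i = n -> good k i -> ~ L i y); split.
  + apply: go_inter; first exact: L_open.
    apply: (@generated_all _ _ nat _ (fun n y => forall i, pickle i = n -> good k i -> ~ L i y)) => n _.
    apply: generated_local => y yn.
    have [[i [ei ki]]|no] := pselect (exists i : K, pickle i = n /\ good k i).
      exists (fun w => ~ L i w); split=> [||w nLi j ej _]; [exact: L_closed|exact: yn|].
      by have -> : j = i by apply: (pcan_inj pickleK); rewrite ei ej.
    exists (fun=> True); split=> // [|w _ i ei ki]; first exact: go_full.
    by case: no; exists i.
  + by split=> // n; rewrite mem_iota => /= lt i ei ki; apply: Jmin; rewrite ?ei.
  + move=> y [Ly ymin]; congr pickle; apply: least_uniq (fP k y) _.
    by split=> // i ki lt; apply: (ymin (pickle i)) => //; rewrite mem_iota.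
- move=> x s sP.
  have /choice [Js JsP] (k : K) : exists j : K, s k = pickle j.
    by have [y [_ /(_ k (mem_head _ _)) <-]] := sP 0 [:: k]; exists (J k y).
  have realize n k i : exists y, [/\ forall t, t < n -> y t = x t, J k y = Js k & J i y = Js i].
    have [y [yx yP]] := sP n [:: k; i].
    exists y; split=> //; apply: (pcan_inj pickleK).
      by rewrite yP ?inE ?eqxx // JsP.
    by rewrite yP ?inE ?eqxx ?orbT // JsP.
  have Js_near n k : exists y, [/\ forall t, t < n -> y t = x t & L (Js k) y].
    by have [y [yx <- _]] := realize n k k; exists y; split=> //; case: (fP k y).
  (* A word realising the coordinates [k] and [Js k] lies in both [L (Js k)] and [L (Js (Js k))];
     these are not disjoint, so only advancing remains. *)
  have Js_adv k : advances (Js k) (Js (Js k)).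
    have [y [_ y1 y2]] := realize 0 k (Js k).
    have [Ly _ _] := fP k y; rewrite y1 in Ly.
    have := fP (Js k) y; rewrite y2 => -[L2y [//|disj] _].
    by case: (disj y L2y).
  have LJs k : L (Js k) x by apply: (@buchi_limit_run x Js).
  have kJs k : good k (Js k).
    by have [y [_ <- _]] := realize 0 k k; case: (fP k y).
  (* Minimality: a word [y] realising [k] and [i] avoids the smaller candidate [L i], so [Js i] does
     not advance [i] and is disjoint from it; yet [x] lies in both [L (Js i)] and [L i]. *)
  move=> k; rewrite JsP; congr pickle; apply: least_uniq (fP k x) _; split=> // i ki lt Lix.
  have [y [_ yk yi]] := realize 0 k i.
  have [_ _ /(_ i ki)] := fP k y; rewrite yk => /(_ lt) nLiy.
  have [Ly gi _] := fP i y; rewrite yi in Ly gi.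
  case: gi => [adv|disj]; first by apply: nLiy; apply: advances_sub adv _ Ly.
  exact: disj (LJs i) Lix.
- move=> U x [A AP] Ux; have [c cP] := automaton_code A.
  pose k : K := existT _ c [::].
  have LU y : L k y <-> U y by rewrite AP -cP; apply: lang_from_nil.
  exists 0, [:: k] => y _ /(_ k (mem_head _ _))/(pcan_inj pickleK) Jy.
  have [Lx [adv|disj] _] := fP k x; last by case: (disj x Lx); apply/LU.
  by apply/LU; apply: advances_sub adv _ _; rewrite -Jy; case: (fP k y).
Qed.

End Buchi.

(** * Recursive functions *)

(** [PComp] nests a list of programs, so the induction hypothesis for its members is passed as a
    [Forall]. *)
Fixpoint prf_nested_ind (P : prf -> Prop) (Hzero : P PZero) (Hsucc : P PSucc)
    (Hproj : forall i, P (PProj i))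
    (Hcomp : forall f gs, P f -> Forall P gs -> P (PComp f gs))
    (Hprec : forall f g, P f -> P g -> P (PPrec f g))
    (Hmu : forall f, P f -> P (PMu f)) (p : prf) : P p :=
  let IH := prf_nested_ind Hzero Hsucc Hproj Hcomp Hprec Hmu in
  match p with
  | PZero => Hzero
  | PSucc => Hsucc
  | PProj i => Hproj i
  | PComp f gs => Hcomp f gs (IH f)
      ((fix all_gs l : Forall P l :=
          match l with
          | [::] => Forall_nil P
          | g :: l' => Forall_cons g (IH g) (all_gs l')
          end) gs)
  | PPrec f g => Hprec f g (IH f) (IH g)
  | PMu f => Hmu f (IH f)
  end.

(** Ensures that the code of a program determines the function it computes. *)
Lemma peval_det p v k k' : peval p v k -> peval p v k' -> k = k'.
Proof.
elim/prf_nested_ind: p v k k' => [||i|f gs IHf IHgs|f g IHf IHg|f IHf] v k k' Hk.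
- by inversion Hk; subst=> Hk'; inversion Hk'.
- by inversion Hk; subst=> Hk'; inversion Hk'.
- by inversion Hk; subst=> Hk'; inversion Hk'.
- inversion Hk as [| | |? ? ? ys ? Hys Hf| | |]; subst=> Hk'.
  inversion Hk' as [| | |? ? ? ys' ? Hys' Hf'| | |]; subst.
  suff E : ys = ys' by subst; apply: IHf Hf Hf'.
  move: {Hf Hf' Hk Hk'} ys' Hys'; elim: Hys IHgs => [|g y gs' ys0 gy _ IH] IHgs ys' Hys'.
    by inversion Hys'.
  inversion Hys' as [|? y' ? ys'' gy' rest]; subst; inversion IHgs as [|? ? IHg IHgs']; subst.
  by congr cons; [apply: IHg gy gy'|apply: IH IHgs' _ rest].
- have det n w y y' : peval (PPrec f g) (n :: w) y -> peval (PPrec f g) (n :: w) y' -> y = y'.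
    elim: n y y' => [|n IHn] y y' Hy Hy'.
      inversion Hy; subst; inversion Hy'; subst; apply: IHf; eassumption.
    inversion Hy as [| | | | |? ? ? ? z ? Hz Hg|]; subst.
    inversion Hy' as [| | | | |? ? ? ? z' ? Hz' Hg'|]; subst.
    have E := IHn _ _ Hz Hz'; subst; exact: IHg Hg Hg'.
  by case: v Hk => [|n w] Hk Hk'; [inversion Hk|apply: det Hk Hk'].
- inversion Hk as [| | | | | |? ? ? H0 Hlt]; subst=> Hk'.
  inversion Hk' as [| | | | | |? ? ? H0' Hlt']; subst.
  case: (ltngtP k k') => // [/Hlt'|/Hlt] [m [m_neq0 Hm]]; case: m_neq0.
    exact: IHf Hm H0.
  exact: IHf Hm H0'.
Qed.

(** Generic trees form a countable type, so programs can index coordinates through them. *)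
Fixpoint prf_tree (p : prf) : GenTree.tree nat :=
  match p with
  | PZero => GenTree.Node 0 [::]
  | PSucc => GenTree.Node 1 [::]
  | PProj i => GenTree.Leaf i
  | PComp f gs => GenTree.Node 2 (prf_tree f :: List.map prf_tree gs)
  | PPrec f g => GenTree.Node 3 [:: prf_tree f; prf_tree g]
  | PMu f => GenTree.Node 4 [:: prf_tree f]
  end.

Fixpoint tree_prf (t : GenTree.tree nat) : prf :=
  match t with
  | GenTree.Leaf i => PProj i
  | GenTree.Node 1 _ => PSucc
  | GenTree.Node 2 (f :: gs) => PComp (tree_prf f) (List.map tree_prf gs)
  | GenTree.Node 3 [:: f; g] => PPrec (tree_prf f) (tree_prf g)
  | GenTree.Node 4 [:: f] => PMu (tree_prf f)
  | _ => PZero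
  end.

Lemma prf_treeK p : tree_prf (prf_tree p) = p.
Proof.
elim/prf_nested_ind: p => //= [f gs -> IHgs|f g -> ->|f ->] //.
by congr PComp; elim: IHgs => //= g l -> _ ->.
Qed.

(** * Closure properties of total recursive functions *)

Fixpoint env n := if n is n'.+1 then (nat * env n')%type else unit.

(** Nested pairs let the arguments be named [e.1], [e.2.1] and so on; [env_seq] gives the list that
    [peval] expects. *)
Fixpoint env_seq n : env n -> seq nat :=
  if n is n'.+1 then fun e => e.1 :: env_seq e.2 else fun=> [::].

Definition recf n (f : env n -> nat) :=
  exists p, forall e, peval p (env_seq e) (f e).

Definition recs n m (f : env n -> env m) :=
  exists ps, forall e, Forall2 (fun p y => peval p (env_seq e) y) ps (env_seq (f e)).

Lemma recf_ext n (f g : env n -> nat) : recf f -> (forall e, f e = g e) -> recf g.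
Proof. by move=> [p pP] fg; exists p => e; rewrite -fg. Qed.

Lemma recf_comp n m (f : env m -> nat) (g : env n -> env m) :
  recf f -> recs g -> recf (fun e => f (g e)).
Proof. by move=> [p pP] [ps psP]; exists (PComp p ps) => e; apply: ev_comp. Qed.

Lemma recs_nil n (f : env n -> env 0) : recs f.
Proof. by exists [::] => e; constructor. Qed.

Lemma recs_cons n m (f : env n -> nat) (g : env n -> env m) :
  recf f -> recs g -> @recs n m.+1 (fun e => (f e, g e)).
Proof. by move=> [p pP] [ps psP]; exists (p :: ps) => e; constructor. Qed.

Lemma recf_const n c : @recf n (fun=> c).
Proof.
elim: c => [|c [p pP]]; first by exists PZero => e; constructor.
exists (PComp PSucc [:: p]) => e; apply: (@ev_comp _ _ _ [:: c]); last exact: ev_succ.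
by constructor.
Qed.

Lemma recf_v0 n : @recf n.+1 (fun e => e.1).
Proof. by exists (PProj 0) => e; apply: (@ev_proj 0 (env_seq e)) => /=; lia. Qed.

Lemma recs_snd n : @recs n.+1 n (fun e => e.2).
Proof.
have shift s l : Forall2 (fun p y => peval p (s ++ l) y)
    (List.map PProj (iota (size s) (size l))) l.
  elim: l s => [|a l IHl] s /=; first by constructor.
  constructor; last first.
    by have := IHl (rcons s a); rewrite cat_rcons size_rcons.
  have E : List.nth (size s) (s ++ a :: l) 0 = a by elim: s.
  have := @ev_proj (size s) (s ++ a :: l); rewrite E; apply.
  apply/ltP; change (is_true (size s < size (s ++ a :: l))).
  by rewrite size_cat /=; lia.
have sizeE : forall m (e : env m), size (env_seq e) = m by elim=> //= m IHm e; rewrite IHm.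
exists (List.map PProj (iota 1 n)) => e.
by have := shift [:: e.1] (env_seq e.2); rewrite sizeE.
Qed.

Lemma recf_weak n (f : env n -> nat) : recf f -> @recf n.+1 (fun e => f e.2).
Proof. by move=> fP; apply: recf_comp fP (recs_snd n). Qed.

Lemma recs_weak n m (f : env n -> env m) : recs f -> @recs n.+1 m (fun e => f e.2).
Proof.
elim: m f => [|m IHm] f fP; first exact: recs_nil.
have [ps psP] := fP.
have fst_f : recf (fun e => (f e).1) by apply: recf_comp (recf_v0 m) fP.
have snd_f : recs (fun e => (f e).2).
  exists (behead ps) => e; have := psP e; move=> H; by inversion H.
have := recs_cons (recf_weak fst_f) (IHm _ snd_f).
by move=> [qs qsP]; exists qs => e; have := qsP e.
Qed.

Lemma recs_id n : @recs n n id.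
Proof.
case: n => [|n]; first exact: recs_nil.
have [ps psP] := recs_cons (recf_v0 n) (recs_snd n).
by exists ps => e; have := psP e.
Qed.

Lemma recf_v1 n : @recf n.+2 (fun e => e.2.1).
Proof. exact: recf_weak (recf_v0 n). Qed.
Lemma recf_v2 n : @recf n.+3 (fun e => e.2.2.1).
Proof. exact: recf_weak (recf_v1 n). Qed.
Lemma recf_v3 n : @recf n.+4 (fun e => e.2.2.2.1).
Proof. exact: recf_weak (recf_v2 n). Qed.
Lemma recf_v4 n : @recf n.+4.+1 (fun e => e.2.2.2.2.1).
Proof. exact: recf_weak (recf_v3 n). Qed.

Lemma recf_prec n (f : env n -> nat) (g : nat -> nat -> env n -> nat) :
  recf f -> @recf n.+2 (fun e => g e.1 e.2.1 e.2.2) ->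
  @recf n.+1 (fun e => iteri e.1 (fun k y => g k y e.2) (f e.2)).
Proof.
move=> [p pP] [q qP]; exists (PPrec p q) => -[k e] /=.
elim: k => [|k IHk]; first by apply: ev_prec0.
exact: ev_precS IHk (qP (k, (_, e))).
Qed.

Lemma recf_iteri n (h f : env n -> nat) (g : nat -> nat -> env n -> nat) :
  recf h -> recf f -> @recf n.+2 (fun e => g e.1 e.2.1 e.2.2) ->
  recf (fun e => iteri (h e) (fun k y => g k y e) (f e)).
Proof.
move=> hP fP gP; exact: (recf_comp (recf_prec fP gP) (recs_cons hP (recs_id n))).
Qed.

Definition rec1 (g : nat -> nat) := @recf 1 (fun e => g e.1).
Definition rec2 (g : nat -> nat -> nat) := @recf 2 (fun e => g e.1 e.2.1).

Lemma recf_app1 g n (f : env n -> nat) : rec1 g -> recf f -> recf (fun e => g (f e)).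
Proof. by move=> gP fP; apply: (recf_comp gP (recs_cons fP (recs_nil (fun=> tt)))). Qed.

Lemma recf_app2 g n (f1 f2 : env n -> nat) :
  rec2 g -> recf f1 -> recf f2 -> recf (fun e => g (f1 e) (f2 e)).
Proof.
by move=> gP fP1 fP2; apply: (recf_comp gP (recs_cons fP1 (recs_cons fP2 (recs_nil (fun=> tt))))).
Qed.

Lemma recf_succ n (f : env n -> nat) : recf f -> recf (fun e => (f e).+1).
Proof. by apply: recf_app1; exists PSucc => e /=; apply: ev_succ. Qed.

Lemma recf_pred n (f : env n -> nat) : recf f -> recf (fun e => (f e).-1).
Proof.
move=> fP; apply: recf_ext (@recf_iteri _ _ _ (fun k _ _ => k) fP (recf_const _ 0) (recf_v0 _)) _.
by move=> e; case: (f e).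
Qed.

Section Closure.
Variable n : nat.
Implicit Types (f g h : env n -> nat) (P Q : env n -> bool).

Lemma recf_add f g : recf f -> recf g -> recf (fun e => f e + g e).
Proof.
move=> fP gP; apply: recf_ext (@recf_iteri _ _ _ (fun _ y _ => y.+1) gP fP _) _.
  exact/recf_succ/recf_v1.
by move=> e; elim: (g e) => [|k /= ->]; rewrite ?addn0 ?addnS.
Qed.

Lemma recf_sub f g : recf f -> recf g -> recf (fun e => f e - g e).
Proof.
move=> fP gP; apply: recf_ext (@recf_iteri _ _ _ (fun _ y _ => y.-1) gP fP _) _.
  exact/recf_pred/recf_v1.
by move=> e; elim: (g e) => [|k /= ->]; rewrite ?subn0 ?subnS.
Qed.

Lemma recf_not P : recf (fun e => P e : nat) -> recf (fun e => ~~ P e : nat).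
Proof.
move=> Pr; apply: recf_ext (recf_sub (recf_const _ 1) Pr) _.
by move=> e; case: (P e).
Qed.

Lemma recf_leq f g : recf f -> recf g -> recf (fun e => (f e <= g e : nat)).
Proof.
move=> fP gP; apply: recf_ext (recf_sub (recf_const _ 1) (recf_sub fP gP)) _.
by move=> e; rewrite /leq; case: (f e - g e).
Qed.

Lemma recf_and P Q : recf (fun e => P e : nat) -> recf (fun e => Q e : nat) ->
  recf (fun e => P e && Q e : nat).
Proof.
move=> Pr Qr; apply: recf_ext (recf_sub Pr (recf_sub (recf_const _ 1) Qr)) _.
by move=> e; case: (P e); case: (Q e).
Qed.

Lemma recf_or P Q : recf (fun e => P e : nat) -> recf (fun e => Q e : nat) ->
  recf (fun e => P e || Q e : nat).
Proof.
move=> Pr Qr; apply: recf_ext (recf_not (recf_and (recf_not Pr) (recf_not Qr))) _.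
by move=> e; case: (P e); case: (Q e).
Qed.

Lemma recf_imp P Q : recf (fun e => P e : nat) -> recf (fun e => Q e : nat) ->
  recf (fun e => P e ==> Q e : nat).
Proof.
move=> Pr Qr; apply: recf_ext (recf_or (recf_not Pr) Qr) _.
by move=> e; case: (P e).
Qed.

Lemma recf_eq f g : recf f -> recf g -> recf (fun e => (f e == g e : nat)).
Proof.
move=> fP gP; apply: recf_ext (recf_and (recf_leq fP gP) (recf_leq gP fP)) _.
by move=> e; rewrite eqn_leq.
Qed.

Lemma recf_if P f g : recf (fun e => P e : nat) -> recf f -> recf g ->
  recf (fun e => if P e then f e else g e).
Proof.
move=> Pr fP gP; apply: recf_ext (@recf_iteri _ _ _ (fun _ _ => f) Pr gP _) _.
  exact: recf_weak (recf_weak fP).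
by move=> e; case: (P e).
Qed.

Lemma recf_ifb P Q (R : env n -> bool) : recf (fun e => P e : nat) -> recf (fun e => Q e : nat) ->
  recf (fun e => R e : nat) -> recf (fun e => (if P e then Q e else R e) : nat).
Proof.
move=> Pr Qr Rr; apply: recf_ext (recf_if Pr Qr Rr) _.
by move=> e; case: (P e).
Qed.

End Closure.

Lemma recf_all n (P : nat -> env n -> bool) (h : env n -> nat) : recf h ->
  @recf n.+1 (fun e => P e.1 e.2 : nat) ->
  recf (fun e => all (P^~ e) (iota 0 (h e)) : nat).
Proof.
move=> hP Pr.
apply: recf_ext (@recf_iteri _ _ (fun=> 1) (fun k y e => if P k e then y else 0) hP (recf_const _ 1) _) _.
  refine (@recf_if n.+2 (fun e => P e.1 e.2.2) _ (fun=> 0) _ (recf_v1 n) (recf_const _ 0)).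
  exact: (recf_comp Pr (recs_cons (recf_v0 _) (recs_weak (recs_snd _)))).
move=> e; elim: (h e) => // k IHk; rewrite -[in iota 0 _]addn1 iotaD all_cat /= IHk.
by case: (P k e); rewrite ?andbT ?andbF.
Qed.


Lemma recf_has n (P : nat -> env n -> bool) (h : env n -> nat) : recf h ->
  @recf n.+1 (fun e => P e.1 e.2 : nat) ->
  recf (fun e => has (P^~ e) (iota 0 (h e)) : nat).
Proof.
move=> hP Pr.
apply: recf_ext (recf_not (@recf_all _ (fun i e => ~~ P i e) _ hP _)) _.
  exact: (@recf_not n.+1 (fun e => P e.1 e.2)).
by move=> e; rewrite -has_predC; congr (nat_of_bool _); apply: eq_has => i /=; rewrite negbK.
Qed.

Lemma recf_find n (P : nat -> env n -> bool) (h : env n -> nat) : recf h ->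
  @recf n.+1 (fun e => P e.1 e.2 : nat) ->
  recf (fun e => find (P^~ e) (iota 0 (h e))).
Proof.
move=> hP Pr.
(* Before step [k] the accumulator is the first hit below [k], or [k] if there is none; [y < k]
   means that the search is over. *)
apply: recf_ext (@recf_iteri _ _ (fun=> 0)
  (fun k y e => if (y < k) || P k e then y else y.+1) hP (recf_const _ 0) _) _.
  refine (@recf_if n.+2 (fun e => (e.2.1 < e.1) || P e.1 e.2.2) _ _ _
            (recf_v1 n) (recf_succ (recf_v1 n))).
  refine (@recf_or n.+2 (fun e => e.2.1 < e.1) (fun e => P e.1 e.2.2)
            (recf_leq (recf_succ (recf_v1 n)) (recf_v0 n.+1)) _).
  exact: (recf_comp Pr (recs_cons (recf_v0 _) (recs_weak (recs_snd _)))).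
move=> e; elim: (h e) => // k IHk; rewrite [LHS]/= IHk.
rewrite -[in iota 0 k.+1]addn1 iotaD find_cat /= add0n size_iota.
have -> : (find (P^~ e) (iota 0 k) < k) = has (P^~ e) (iota 0 k) by rewrite has_find size_iota.
case: (boolP (has _ _)) => //= nhas.
have -> : find (P^~ e) (iota 0 k) = k by rewrite hasNfind ?size_iota.
by case: (P k e); rewrite ?addn0 ?addn1.
Qed.

(** Codes nest to the right, so the recursion builds them from the last entry; hence the index
    [m - k.+1]. *)
Lemma seq_code_mkseqE (f : nat -> nat) m :
  seq_code (mkseq f m) = iteri m (fun k y => (cpair (f (m - k.+1)) y).+1) 0.
Proof.
suff H j : j <= m -> seq_code (map f (iota (m - j) j)) =
    iteri j (fun k y => (cpair (f (m - k.+1)) y).+1) 0.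
  by rewrite -H // subnn.
elim: j => // j IHj lt_jm; rewrite /= -IHj; last exact: ltnW.
by rewrite -(subnSK lt_jm).
Qed.

Create HintDb recdb.

(* Dispatch on the head symbol: blind [apply] makes the unifier unfold the arithmetic. *)
Ltac recf_step := cbv beta;
  lazymatch goal with
  | |- recf (fun e => S _) => eapply recf_succ
  | |- recf (fun e => predn _) => eapply recf_pred
  | |- recf (fun e => addn _ _) => eapply recf_add
  | |- recf (fun e => subn _ _) => eapply recf_sub
  | |- recf (fun e => nat_of_bool (negb _)) => eapply recf_not
  | |- recf (fun e => nat_of_bool (andb _ _)) => eapply recf_and
  | |- recf (fun e => nat_of_bool (orb _ _)) => eapply recf_or
  | |- recf (fun e => nat_of_bool (implb _ _)) => eapply recf_imp
  | |- recf (fun e => nat_of_bool (leq _ _)) => eapply recf_leq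
  | |- recf (fun e => nat_of_bool (eq_op _ _)) => eapply recf_eq
  | |- recf (fun e => nat_of_bool (all _ _)) => eapply recf_all
  | |- recf (fun e => nat_of_bool (has _ _)) => eapply recf_has
  | |- recf (fun e => nat_of_bool (if _ then _ else _)) => eapply recf_ifb
  | |- recf (fun e => if _ then _ else _) => eapply recf_if
  | |- recf (fun e => find _ _) => eapply recf_find
  | |- recf (fun e => iteri _ _ _) => eapply recf_iteri
  | |- recf fst => exact: recf_v0
  | |- recf (fun=> ?c) => exact: recf_const
  | |- recf (fun e => fst _) => first [exact: recf_v0 | exact: recf_v1 | exact: recf_v2
                                      | exact: recf_v3 | exact: recf_v4]
  | |- recf (fun e => ?g (@?a e) (@?b e)) =>
      apply: (@recf_app2 g _ a b); first by auto with recdb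
  | |- recf (fun e => ?g (@?a e)) => apply: (@recf_app1 g _ a); first by auto with recdb
  end.
Ltac prove_recf := repeat recf_step.

(** * Recursive pairing and codes of finite sequences *)

Lemma tri_sum s : (s * s.+1) %/ 2 = iteri s (fun k y => y + k.+1) 0.
Proof.
elim: s => // s /= <-.
have -> : s.+1 * s.+2 = s * s.+1 + s.+1 * 2 by lia.
by rewrite divnDMl.
Qed.

Lemma rec2_cpair : rec2 cpair.
Proof.
apply: (@recf_ext 2 (fun e => iteri (e.1 + e.2.1) (fun k y => y + k.+1) 0 + e.2.1)).
  prove_recf.
by move=> e; rewrite /cpair tri_sum.
Qed.
#[local] Hint Resolve rec2_cpair : recdb.

Lemma cpairE x y : cpair x y = iteri (x + y) (fun k y => y + k.+1) 0 + y.
Proof. by rewrite /cpair tri_sum. Qed.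

Lemma cpairS0 x y : cpair x y.+1 = (cpair x.+1 y).+1.
Proof. by rewrite !cpairE addnS addSn addnS. Qed.

Lemma cpair0S y : cpair y.+1 0 = (cpair 0 y).+1.
Proof. by rewrite !cpairE !addn0 add0n /=; lia. Qed.

Lemma leq_cpair x y : x + y <= cpair x y.
Proof.
rewrite cpairE; have tri_ge s : s <= iteri s (fun k y => y + k.+1) 0 by elim: s => //= s; lia.
by have := tri_ge (x + y); case: y => [|y] //=; rewrite ?addn0 //; rewrite addnS /=; lia.
Qed.

Lemma cpair_surj c : exists x y, cpair x y = c.
Proof.
elim: c => [|c [x [y <-]]]; first by exists 0, 0.
case: x => [|x]; first by exists y.+1, 0; rewrite cpair0S.
by exists x, y.+1; rewrite cpairS0.
Qed.

Lemma cpair_inj x y x' y' : cpair x y = cpair x' y' -> x = x' /\ y = y'.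
Proof.
rewrite !cpairE; pose tri s := iteri s (fun k y => y + k.+1) 0.
have triS s : tri s.+1 = tri s + s.+1 by [].
have tri_le s s' : s <= s' -> tri s <= tri s'.
  by move=> ss'; rewrite -(subnKC ss'); elim: (s' - s) => [|d]; rewrite ?addn0 // addnS triS; lia.
rewrite -!/(tri _) => eq_tri.
suff eq_s : x + y = x' + y' by move: eq_tri; rewrite eq_s; lia.
case: (ltngtP (x + y) (x' + y')) => // /tri_le; rewrite triS; lia.
Qed.

(** Bounded search suffices because [cpair x y] dominates [x] and [y], and it is visibly
    recursive. *)
Definition cfst c := find (fun x => has (fun y => cpair x y == c) (iota 0 c.+1)) (iota 0 c.+1).
Definition csnd c := find (fun y => has (fun x => cpair x y == c) (iota 0 c.+1)) (iota 0 c.+1).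

Lemma find_iota_uniq (P : pred nat) n k :
  k < n -> P k -> (forall i, P i -> i = k) -> find P (iota 0 n) = k.
Proof.
move=> kn Pk uniq; have hasP : has P (iota 0 n) by apply/hasP; exists k; rewrite ?mem_iota.
have := nth_find 0 hasP; rewrite nth_iota; last by move: hasP; rewrite has_find size_iota.
by move/uniq.
Qed.

Lemma cfstK x y : cfst (cpair x y) = x.
Proof.
have := leq_cpair x y => le_xy; apply: find_iota_uniq => [||i]; first by lia.
  by apply/hasP; exists y; rewrite // mem_iota; lia.
by case/hasP => y' _ /eqP /cpair_inj [].
Qed.

Lemma csndK x y : csnd (cpair x y) = y.
Proof.
have := leq_cpair x y => le_xy; apply: find_iota_uniq => [||i]; first by lia.
  by apply/hasP; exists x; rewrite // mem_iota; lia.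
by case/hasP => y' _ /eqP /cpair_inj [].
Qed.

(** The predecessor undoes the successor in [seq_code]; the empty code [0] is its own tail, so
    dropping past the end stays at [0]. *)
Definition ctail c := csnd c.-1.
Definition cdrop i c := iteri i (fun _ y => ctail y) c.
Definition cnth c i := cfst (cdrop i c).-1.
Definition clen c := find (fun i => cdrop i c == 0) (iota 0 c.+1).

Lemma cdropE i l : cdrop i (seq_code l) = seq_code (drop i l).
Proof.
elim: i => [|i IHi]; first by rewrite drop0.
rewrite /cdrop /= -/(cdrop i _) IHi -addn1 addnC -drop_drop drop1.
by case: (drop i l) => [|a s] /=; rewrite /ctail //= csndK.
Qed.

Lemma cnthE l i : cnth (seq_code l) i = nth 0 l i.
Proof.
rewrite /cnth cdropE -[i in RHS]addn0 -nth_drop.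
by case: (drop i l) => [|a s] //=; rewrite cfstK.
Qed.

Lemma size_seq_code l : size l <= seq_code l.
Proof. by elim: l => //= a l IHl; have := leq_cpair a (seq_code l); lia. Qed.

Lemma clenE l : clen (seq_code l) = size l.
Proof.
rewrite /clen; have -> : find (fun i => cdrop i (seq_code l) == 0) (iota 0 (seq_code l).+1) =
    find (leq (size l)) (iota 0 (seq_code l).+1).
  apply: eq_find => i; rewrite cdropE.
  have [le|lt] := leqP (size l) i; first by rewrite drop_oversize.
  by rewrite (drop_nth 0 lt).
have le := size_seq_code l.
have hasP : has (leq (size l)) (iota 0 (seq_code l).+1).
  by apply/hasP; exists (size l); rewrite // mem_iota.
have lt := hasP; rewrite has_find size_iota in lt.
apply/eqP; rewrite eqn_leq; apply/andP; split; last first.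
  by have := nth_find 0 hasP; rewrite nth_iota.
rewrite leqNgt; apply/negP => gt.
have := before_find 0 gt; rewrite nth_iota ?leqnn //; lia.
Qed.

Lemma seq_code_surj c : exists l, seq_code l = c.
Proof.
elim/ltn_ind: c => -[|c] IHc; first by exists [::].
have [x [y xy]] := cpair_surj c; have [|l ly] := IHc y.
  by have := leq_cpair x y; lia.
by exists (x :: l); rewrite /= ly xy.
Qed.

Lemma recf_seq_code n (f : nat -> env n -> nat) h : recf h ->
  @recf n.+1 (fun e => f e.1 e.2) ->
  recf (fun e => seq_code (mkseq (f^~ e) (h e))).
Proof.
move=> hP fP.
apply: recf_ext (@recf_iteri _ _ (fun=> 0)
  (fun k y e => (cpair (f (h e - k.+1) e) y).+1) hP (recf_const _ 0) _) _.
  apply: (@recf_succ n.+2 (fun e => cpair (f (h e.2.2 - e.1.+1) e.2.2) e.2.1)).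
  refine (@recf_app2 _ n.+2 (fun e => f (h e.2.2 - e.1.+1) e.2.2) _ rec2_cpair _ (recf_v1 n)).
  have sub : @recf n.+2 (fun e => h e.2.2 - e.1.+1).
    exact: (recf_sub (recf_weak (recf_weak hP)) (recf_succ (recf_v0 _))).
  exact: (recf_comp fP (recs_cons sub (recs_weak (recs_snd n)))).
by move=> e; rewrite seq_code_mkseqE.
Qed.

Lemma rec1_cfst : rec1 cfst.
Proof. by rewrite /rec1 /cfst; prove_recf. Qed.

Lemma rec1_csnd : rec1 csnd.
Proof. by rewrite /rec1 /csnd; prove_recf. Qed.
#[local] Hint Resolve rec1_cfst rec1_csnd : recdb.

Lemma rec2_cdrop : rec2 cdrop.
Proof. by rewrite /rec2 /cdrop /ctail; prove_recf. Qed.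
#[local] Hint Resolve rec2_cdrop : recdb.

Lemma rec2_cnth : rec2 cnth.
Proof. by rewrite /rec2 /cnth; prove_recf. Qed.

Lemma rec1_clen : rec1 clen.
Proof. by rewrite /rec1 /clen; prove_recf. Qed.
#[local] Hint Resolve rec2_cnth rec1_clen : recdb.

(** * Well-founded games *)

Section GameValue.
(* A position of a game is the list of the moves made so far, latest first. The position [p] is lost for the player to move if [S p = 0], won if [S p = 1] and open otherwise. *)
Variable S : seq nat -> nat.
Hypothesis S_wf : forall P : nat -> seq nat,
  (forall t, exists i, P t.+1 = i :: P t) -> exists t, S (P t) < 2.

(* The value of a position is [0] if it is lost for the player to move, and [i.+1] if [i] is the least move to a lost position: [value_ok] relates it to the value [b] of the position after the move [i]. *)
Definition value_ok (a i b : nat) :=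
  if a == i.+1 then b == 0 else (a == 0) || (i.+1 < a) ==> (b != 0).

Definition game_value (h : seq nat -> nat) := forall p,
  if S p < 2 then h p = S p else forall i, value_ok (h p) i (h (i :: p)).

Let R q p := ~~ (S p < 2) /\ exists i, q = i :: p.

(** An inaccessible position would start an infinite path of open positions, against [S_wf]. *)
Lemma game_wf : well_founded R.
Proof.
move=> p0; apply: contrapT => nacc.
have /choice [nxt nxtP] (p : {p | ~ Acc R p}) : exists q : {p | ~ Acc R p}, R (sval q) (sval p).
  case: p => p /= nAcc; apply: contrapT => /forallNP noq; apply: nAcc; constructor=> q Rqp.
  by apply: contrapT => nq; apply: (noq (exist _ q nq)).
pose P t := iter t nxt (exist _ p0 nacc).
have PR t : R (sval (P t.+1)) (sval (P t)) by apply: nxtP.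
have [t|t] := S_wf (P := fun t => sval (P t)); first by case: (PR t).
by move=> lt; case: (PR t); rewrite lt.
Qed.

(** For [a < b], the value [b] makes the move [b.-1] lead to a lost position. So [a] is not [0], and
    its move [a.-1] leads to a lost position before the least one. *)
Lemma value_ok_uniq a b (v : nat -> nat) :
  (forall i, value_ok a i (v i)) -> (forall i, value_ok b i (v i)) -> a = b.
Proof.
wlog lt : a b / a < b => [IH va vb|va vb].
  by case: (ltngtP a b) => // lt; [|symmetry]; apply: IH.
case: b lt vb => // b lt vb; have := vb b; rewrite /value_ok eqxx => vb0.
case: a lt va => [|a] lt va; first by have := va b; rewrite /value_ok vb0.
have := vb a; rewrite /value_ok; have := va a; rewrite /value_ok eqxx => ->.
by rewrite eqSS gtn_eqF //= lt.
Qed.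

Lemma value_ok_exists (v : nat -> nat) : exists a, forall i, value_ok a i (v i).
Proof.
have [ex0|no0] := pselect (exists i, v i = 0); last first.
  by exists 0 => i; rewrite /value_ok /=; apply/eqP => vi; apply: no0; exists i.
have [i [vi imin]] := least_nat ex0; exists i.+1 => j; rewrite /value_ok eqSS.
case: eqP => [<-|_]; first by rewrite vi.
by apply/implyP => /= lt; apply/eqP/imin.
Qed.

Lemma game_value_uniq h h' : game_value h -> game_value h' -> h =1 h'.
Proof.
move=> hP hP' p; elim/(well_founded_ind game_wf): p => p IHp.
have := hP p; have := hP' p; case: ifP => [_ -> -> //|/negbT open] vp' vp.
apply: value_ok_uniq vp _ => i; rewrite IHp //.
by split=> //; exists i.
Qed.

Lemma game_value_exists : exists h, game_value h.
Proof.
have [lz lzP] := choice value_ok_exists.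
(* At an open position every move is related by [R], so the default [0] only makes [step] total. *)
pose step p (rec : forall q, R q p -> nat) : nat :=
  if S p < 2 then S p
  else lz (fun i => match pselect (R (i :: p) p) with left r => rec _ r | right _ => 0 end).
exists (Fix game_wf (fun=> nat) step) => p.
rewrite Fix_eq; last first.
  move=> q f g fg; rewrite /step; case: ifP => // _; congr lz; apply/funext => i.
  by case: pselect.
case: ifP => [lt|open i]; first by rewrite /step lt.
pose v j := match pselect (R (j :: p) p) with
  | left _ => Fix game_wf (fun=> nat) step (j :: p) | right _ => 0 end.
have -> : step p (fun q _ => Fix game_wf (fun=> nat) step q) = lz v by rewrite /step open.
have := lzP v i; rewrite {2}/v; case: pselect => [//|[]].
by split; [rewrite open|exists i].
Qed.

End GameValue.

(** * The game of two incompatible closed conditions *)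

Section ClosedGame.
(* At time [2k] the first player chooses [y k], at time [2k+1] the second one chooses [z k]. A player loses as soon as his sequence is refuted, where the first player is tested first. *)
Variables a b : nat -> seq nat -> bool.
Hypothesis ab_disj : forall y z,
  ~ ((forall m, a m (mkseq y m)) /\ (forall m, b m (mkseq z m))).

(** The latest move comes first, so the move made at time [t] has index [size p - t.+1]. *)
Definition even_moves (p : seq nat) m := mkseq (fun k => nth 0 p (size p - (k + k).+1)) m.
Definition odd_moves (p : seq nat) m := mkseq (fun k => nth 0 p (size p - (k + k).+2)) m.

(** Tests take place at even lengths only, where the first player is to move; hence [0] is a defeat
    of the first player and [1] a defeat of the second. *)
Definition status (p : seq nat) : nat :=
  if odd (size p) then 2
  else if all (fun m => (m + m <= size p) ==> a m (even_moves p m)) (iota 0 (size p).+1)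
  then if all (fun m => (m + m <= size p) ==> b m (odd_moves p m)) (iota 0 (size p).+1)
       then 2 else 1
  else 0.

Section Path.
Variable P : nat -> seq nat.
Hypothesis P_path : forall t, exists i, P t.+1 = i :: P t.

Let move k := nth 0 (P k.+1) (size (P k.+1) - k.+1).

Lemma path_size t : size (P t) = size (P 0) + t.
Proof.
elim: t => [|t IHt]; first by rewrite addn0.
by have [i ->] := P_path t; rewrite /= IHt addnS.
Qed.

Lemma path_nth t k : k < size (P t) -> nth 0 (P t) (size (P t) - k.+1) = move k.
Proof.
have step s d : k < size (P s) ->
    nth 0 (P (s + d)) (size (P (s + d)) - k.+1) = nth 0 (P s) (size (P s) - k.+1).
  move=> ks; elim: d => [|d <-]; first by rewrite addn0.
  have lt : k < size (P (s + d)) by have := path_size s; have := path_size (s + d); lia.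
  by rewrite addnS; have [i ->] := P_path (s + d); rewrite /= subSn.
move=> kt; case: (leqP t k.+1) => le.
  by have := step t (k.+1 - t) kt; rewrite subnKC.
have := step k.+1 (t - k.+1); rewrite subnKC //; last exact: ltnW.
by apply; rewrite path_size; lia.
Qed.

Lemma path_even_moves t m : m + m <= size (P t) ->
  even_moves (P t) m = mkseq (fun k => move (k + k)) m.
Proof. by move=> le; apply/mkseq_eqP => k km; rewrite path_nth //; lia. Qed.

Lemma path_odd_moves t m : m + m <= size (P t) ->
  odd_moves (P t) m = mkseq (fun k => move (k + k).+1) m.
Proof. by move=> le; apply/mkseq_eqP => k km; rewrite path_nth //; lia. Qed.

End Path.

Lemma status_wf P : (forall t, exists i, P t.+1 = i :: P t) -> exists t, status (P t) < 2.
Proof.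
move=> Pp; apply: contrapT => /forallNP no.
pose move k := nth 0 (P k.+1) (size (P k.+1) - k.+1).
apply: (ab_disj (y := fun k => move (k + k)) (z := fun k => move (k + k).+1)).
suff H m : a m (mkseq (fun k => move (k + k)) m) /\ b m (mkseq (fun k => move (k + k).+1) m).
  by split=> m; case: (H m).
(* The path may start at any position, so the parity of its first length is compensated. *)
have [t [le ev]] : exists t, m + m <= size (P t) /\ ~~ odd (size (P t)).
  exists (m + m + odd (size (P 0))); rewrite (path_size Pp); split; first by lia.
  by rewrite !oddD; case: (odd m); case: (odd (size _)).
have := no t; rewrite /status (negbTE ev).
have lt : m \in iota 0 (size (P t)).+1 by rewrite mem_iota; lia.
case: allP => [/(_ m lt)|] //; rewrite le path_even_moves // => am.
by case: allP => [/(_ m lt)|] //; rewrite le path_odd_moves.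
Qed.

Section Play.
Variable st : seq nat -> nat.

Definition play t := iter t (fun p => st p :: p) [::].

Lemma play_path t : exists i, play t.+1 = i :: play t.
Proof. by exists (st (play t)). Qed.

Lemma size_play t : size (play t) = t.
Proof. by rewrite (path_size play_path). Qed.

Lemma play_even_moves t m : m + m <= t ->
  even_moves (play t) m = mkseq (fun k => st (play (k + k))) m.
Proof.
move=> le; rewrite (path_even_moves play_path) ?size_play //; apply/mkseq_eqP => k _.
by rewrite size_play subnn.
Qed.

Lemma play_odd_moves t m : m + m <= t ->
  odd_moves (play t) m = mkseq (fun k => st (play (k + k).+1)) m.
Proof.
move=> le; rewrite (path_odd_moves play_path) ?size_play //; apply/mkseq_eqP => k _.
by rewrite size_play subnn.
Qed.

End Play.

(** If the start had value [0], the second player could answer [y] by the least winning moves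
    [(h p).-1], keeping the value [0] exactly when the first player is to move. Such a play never
    ends: [y] is not refuted, and a defeat of the second player has value [1]. This contradicts
    [status_wf]. *)
Lemma value_first_wins h y : game_value status h ->
  (forall m, a m (mkseq y m)) -> h [::] != 0.
Proof.
move=> hP ay; apply/negP => h0.
pose st p := if odd (size p) then (h p).-1 else y (size p)./2.
have st_even k : st (play st (k + k)) = y k.
  by rewrite /st size_play addnn odd_double doubleK.
suff inv : forall t, (h (play st t) == 0) = ~~ odd t /\ ~~ (status (play st t) < 2).
  by have [t] := status_wf (play_path st); have [_ /negbTE ->] := inv t.
have opn t : (h (play st t) == 0) = ~~ odd t -> ~~ (status (play st t) < 2).
  move=> ht; have := hP (play st t); rewrite /status size_play.
  case: (boolP (odd t)) ht => [//|_ ht].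
  case: allP => [_|[]]; last first.
    move=> m _; apply/implyP => le; rewrite play_even_moves //.
    by rewrite (_ : mkseq _ m = mkseq y m) //; apply/mkseq_eqP => k _.
  by case: allP => //= _ E; rewrite E in ht.
move=> t; elim: t => [|t [ht open]]; first by have /opn : (h (play st 0) == 0) = ~~ odd 0.
suff ht1 : (h (play st t.+1) == 0) = ~~ odd t.+1 by split=> //; apply: opn.
have := hP (play st t); rewrite (negbTE open) => /(_ (st (play st t))).
rewrite -[_ :: _]/(play st t.+1) /value_ok /= negbK.
case: (boolP (odd t)) ht => [ot|et] /= ht.
  rewrite /st size_play ot prednK; last by rewrite lt0n ht.
  by rewrite eqxx.
by rewrite (eqP (idP ht)) /= => /negbTE.
Qed.

(** Dually, a nonzero value at the start lets the first player move by [(h p).-1] against [z]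
    without end. *)
Lemma value_second_wins h z : game_value status h ->
  (forall m, b m (mkseq z m)) -> h [::] = 0.
Proof.
move=> hP bz; apply: contrapT => h0.
pose st p := if odd (size p) then z (size p)./2 else (h p).-1.
have st_odd k : st (play st (k + k).+1) = z k.
  by rewrite /st size_play /= addnn odd_double /= uphalf_double.
suff inv : forall t, (h (play st t) == 0) = odd t /\ ~~ (status (play st t) < 2).
  by have [t] := status_wf (play_path st); have [_ /negbTE ->] := inv t.
have opn t : (h (play st t) == 0) = odd t -> ~~ (status (play st t) < 2).
  move=> ht; have := hP (play st t); rewrite /status size_play.
  case: (boolP (odd t)) ht => [//|_ ht].
  case: allP => [_|_ /= E]; last by rewrite E in ht.
  case: allP => // -[] m _; apply/implyP => le; rewrite play_odd_moves //.
  by rewrite (_ : mkseq _ m = mkseq z m) //; apply/mkseq_eqP => k _.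
move=> t; elim: t => [|t [ht open]].
  have h00 : (h (play st 0) == 0) = odd 0 by apply/eqP.
  by split=> //; apply: opn.
suff ht1 : (h (play st t.+1) == 0) = odd t.+1 by split=> //; apply: opn.
have := hP (play st t); rewrite (negbTE open) => /(_ (st (play st t))).
rewrite -[_ :: _]/(play st t.+1) /value_ok /=.
case: (boolP (odd t)) ht => [ot|et] /= ht.
  by rewrite (eqP (idP ht)) /= => /negbTE.
rewrite /st size_play (negbTE et) prednK; last by rewrite lt0n ht.
by rewrite eqxx => ->.
Qed.

End ClosedGame.

(** * The topology of effectively Borel sets *)

(** Counterparts on codes of initial segments, [even_moves] and [odd_moves]. *)
Definition ctake c m := seq_code (mkseq (fun k => cnth c k) m).
Definition ceven c m := seq_code (mkseq (fun k => cnth c (clen c - (k + k).+1)) m).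
Definition codd c m := seq_code (mkseq (fun k => cnth c (clen c - (k + k).+2)) m).

Lemma rec2_ctake : rec2 ctake.
Proof.
by apply: (@recf_seq_code 2 (fun k e => cnth e.1 k) (fun e => e.2.1)); prove_recf.
Qed.

Lemma rec2_ceven : rec2 ceven.
Proof.
by apply: (@recf_seq_code 2 (fun k e => cnth e.1 (clen e.1 - (k + k).+1)) (fun e => e.2.1)); prove_recf.
Qed.

Lemma rec2_codd : rec2 codd.
Proof.
by apply: (@recf_seq_code 2 (fun k e => cnth e.1 (clen e.1 - (k + k).+2)) (fun e => e.2.1)); prove_recf.
Qed.

#[local] Hint Resolve rec2_ctake rec2_ceven rec2_codd : recdb.

Lemma has_double n : has (fun m => m + m == n) (iota 0 n.+1) = ~~ odd n.
Proof.
apply/hasP/idP => [[m _ /eqP <-]|ev]; first by rewrite addnn odd_double.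
exists n./2; first by rewrite mem_iota; lia.
by rewrite addnn even_halfK.
Qed.

(** * A recursive test of value functions on finite approximations *)

Section Check.
Variables F G : nat -> nat -> nat.

Definition cstatus x c : nat :=
  if has (fun m => m + m == clen c) (iota 0 (clen c).+1) then
    if all (fun m => (m + m <= clen c) ==> (F (ctake x m) (ceven c m) == 0)) (iota 0 (clen c).+1)
    then if all (fun m => (m + m <= clen c) ==> (G (ctake x m) (codd c m) == 0)) (iota 0 (clen c).+1)
         then 2 else 1
    else 0
  else 2.

(** [y] lists values indexed by codes of positions. A local condition is tested as soon as the codes
    [c] of the position and [(cpair i c).+1] of its successor are below the length of [x], so the
    tests at all lengths cover all conditions. *)
Definition check x y : bool :=
  all (fun c => if cstatus x c < 2 then cnth y c == cstatus x c
                else all (fun i => ((cpair i c).+1 < clen x) ==>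
                            value_ok (cnth y c) i (cnth y (cpair i c).+1))
                      (iota 0 (clen x)))
    (iota 0 (clen x)).

Section Rec.
Hypotheses (Frec : rec2 F) (Grec : rec2 G).

Lemma rec2_cstatus : rec2 cstatus.
Proof. by rewrite /rec2 /cstatus; prove_recf. Qed.
#[local] Hint Resolve rec2_cstatus : recdb.

Lemma recf_check : @recf 2 (fun e => check e.1 e.2.1 : nat).
Proof. by rewrite /check /value_ok; prove_recf. Qed.

End Rec.

Variable X : nat -> nat.
Let xc n := seq_code (mkseq X n).
Let a m u := F (xc m) (seq_code u) == 0.
Let b m u := G (xc m) (seq_code u) == 0.

Lemma ctake_mkseq n m : m <= n -> ctake (xc n) m = xc m.
Proof.
move=> mn; congr seq_code; apply/mkseq_eqP => k km.
by rewrite cnthE nth_mkseq // (leq_trans km).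
Qed.

Lemma cstatusE n p : size p <= n -> cstatus (xc n) (seq_code p) = status a b p.
Proof.
move=> pn; rewrite /cstatus /status has_double clenE if_neg.
have evenE m : ceven (seq_code p) m = seq_code (even_moves p m).
  by congr seq_code; apply/mkseq_eqP => k _; rewrite cnthE clenE.
have oddE m : codd (seq_code p) m = seq_code (odd_moves p m).
  by congr seq_code; apply/mkseq_eqP => k _; rewrite cnthE clenE.
have allE (H : nat -> nat -> nat) (c : nat -> nat) (mv : nat -> seq nat) :
    (forall m, c m = seq_code (mv m)) ->
    all (fun m => (m + m <= size p) ==> (H (ctake (xc n) m) (c m) == 0)) (iota 0 (size p).+1) =
    all (fun m => (m + m <= size p) ==> (H (xc m) (seq_code (mv m)) == 0)) (iota 0 (size p).+1).
  move=> cE; apply: eq_in_all => m _; case: leqP => //= le; rewrite cE ctake_mkseq //; lia.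
by rewrite (allE F _ _ evenE) (allE G _ _ oddE).
Qed.

Lemma checkP y : (forall n, check (xc n) (seq_code (mkseq y n))) <->
  game_value (status a b) (fun p => y (seq_code p)).
Proof.
have len n : clen (xc n) = n by rewrite clenE size_mkseq.
have nthy n c : c < n -> cnth (seq_code (mkseq y n)) c = y c.
  by move=> cn; rewrite cnthE nth_mkseq.
split=> [chk p|val n].
  have sz := size_seq_code p.
  case: ifP => [lt|open i].
    have /allP/(_ (seq_code p)) := chk (seq_code p).+1.
    rewrite len mem_iota ltnSn => /(_ isT); rewrite cstatusE; last exact: leqW.
    by rewrite lt nthy // => /eqP.
  set c' := (cpair i (seq_code p)).+1; have le := leq_cpair i (seq_code p).
  have /allP/(_ (seq_code p)) := chk c'.+1.
  rewrite len mem_iota leq0n add0n => /(_ ltac:(lia)); rewrite cstatusE; last by lia.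
  rewrite open => /allP /(_ i); rewrite mem_iota leq0n add0n => /(_ ltac:(lia)).
  by rewrite -/c' ltnSn !nthy //; lia.
apply/allP => c; rewrite len mem_iota leq0n add0n => cn.
have [p pc] := seq_code_surj c; have sz := size_seq_code p.
rewrite -pc in cn *; rewrite cstatusE; last by lia.
have := val p; case: ifP => [lt <-|open vi]; first by rewrite nthy.
apply/allP => i _; apply/implyP => lt.
by rewrite !nthy //; apply: (vi i).
Qed.

End Check.

(** In [recursive_rel2] the value [0] means truth, hence the negation. *)
Lemma recursive_bool (W : nat -> nat -> bool) :
  @recf 2 (fun e => W e.1 e.2.1 : nat) -> recursive_rel2 (fun a b => W a b).
Proof.
move=> /(@recf_not 2 (fun e => W e.1 e.2.1)) [p pP]; exists p => a b.
exists (~~ W a b); split; first exact: (pP (a, (b, tt))).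
by case: (W a b).
Qed.

(** * Coordinates for Delta11 sets *)

Section Delta.
Variable Sigma : finType.
Implicit Types (x : word Sigma) (U : word Sigma -> Prop).

Let code x n := seq_code (map (@sym_code Sigma) (mkseq x n)).

Lemma codeE x n : code x n = seq_code (mkseq (fun k => sym_code (x k)) n).
Proof. by rewrite /code -map_comp. Qed.

Lemma Sigma11_bool (W : nat -> nat -> bool) U :
  @recf 2 (fun e => W e.1 e.2.1 : nat) ->
  (forall x, U x <-> exists y, forall n, W (code x n) (seq_code (mkseq y n))) ->
  Sigma11 U.
Proof. by move=> /recursive_bool rW UW; exists (fun a b => W a b). Qed.

Lemma Delta11_letter m a : @Delta11 Sigma (fun x => x m = a).
Proof.
have code_m x n : m < n -> cnth (code x n) m = sym_code (x m).
  by move=> mn; rewrite codeE cnthE nth_mkseq.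
have len x n : clen (code x n) = n by rewrite clenE size_map size_mkseq.
have sym_inj b c : @sym_code Sigma b = sym_code c -> b = c.
  by move=> /val_inj/enum_rank_inj.
split.
  apply: (@Sigma11_bool (fun c _ => (m < clen c) ==> (cnth c m == sym_code a))); first by prove_recf.
  move=> x; split=> [xm|[y /(_ m.+1)]].
    by exists id => n; rewrite len; apply/implyP => mn; rewrite code_m // xm.
  by rewrite len ltnSn code_m // => /eqP /sym_inj.
apply: (@Sigma11_bool (fun c _ => (m < clen c) ==> ~~ (cnth c m == sym_code a))); first by prove_recf.
move=> x; split=> [xm|[y /(_ m.+1)]].
  exists id => n; rewrite len; apply/implyP => mn; rewrite code_m //.
  by apply/eqP => /sym_inj.
by rewrite len ltnSn code_m // => /= /eqP + xa; rewrite xa.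
Qed.

Let represents (F : nat -> nat -> nat) U :=
  forall x, U x <-> exists y, forall n, F (code x n) (seq_code (mkseq y n)) = 0.

(* Suslin-Kleene: the members of a Delta11 set are recognised by a uniquely determined witness, here the value function of a clopen game. *)
Lemma Delta11_witness F G U : rec2 F -> rec2 G ->
  represents F U -> represents G (fun x => ~ U x) ->
  exists2 f : word Sigma -> nat -> nat,
    (forall x y, f x =1 y <-> forall n, check F G (code x n) (seq_code (mkseq y n))) &
    (forall x, U x <-> f x 0 <> 0).
Proof.
move=> Frec Grec FU GU.
pose a x m u := F (code x m) (seq_code u) == 0.
pose b x m u := G (code x m) (seq_code u) == 0.
have ab_disj x y z : ~ ((forall m, a x m (mkseq y m)) /\ (forall m, b x m (mkseq z m))).
  move=> [ay bz]; have Ux : U x by apply/FU; exists y => n; apply/eqP/ay.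
  suff nUx : ~ U x by [].
  by apply/GU; exists z => n; apply/eqP/bz.
have statE x p : status (a x) (b x) p = status
    (fun m u => F (seq_code (mkseq (fun k => sym_code (x k)) m)) (seq_code u) == 0)
    (fun m u => G (seq_code (mkseq (fun k => sym_code (x k)) m)) (seq_code u) == 0) p.
  by rewrite /status /a /b; under eq_all do rewrite codeE; under [X in if X then 2 else 1]eq_all do rewrite codeE.
have wf x := status_wf (@ab_disj x).
have /choice [h hP] x := game_value_exists (wf x).
have /choice [dec decK] := seq_code_surj.
have codeK p : dec (seq_code p) = p.
  have inj : injective seq_code.
    elim=> [|i l IHl] [|j l'] //= [/cpair_inj [-> /IHl ->]] //.
  exact/inj/decK.
have chk x y : (forall n, check F G (code x n) (seq_code (mkseq y n))) <->
    game_value (status (a x) (b x)) (fun p => y (seq_code p)).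
  under eq_forall do rewrite codeE.
  rewrite checkP /game_value; split=> val p; have := val p; by rewrite statE.
exists (fun x c => h x (dec c)) => [x y|x].
  rewrite chk; split=> [fy p|val c].
    have := hP x p; rewrite -fy codeK; case: ifP => // _ vi i.
    by rewrite -fy codeK.
  rewrite -[c in RHS]decK; exact: (game_value_uniq (wf x) (hP x) val).
have -> : dec 0 = [::] by rewrite -[0]/(seq_code [::]) codeK.
split=> [/FU [y yP]|h0].
  by apply/eqP; apply: (value_first_wins (@ab_disj x) (hP x) (y := y)) => m; apply/eqP.
apply: contrapT => /GU [z zP]; apply: h0.
by apply: (value_second_wins (@ab_disj x) (hP x) (z := z)) => m; apply/eqP.
Qed.

(** [f x] is the only sequence that passes all checks. Hence both [f x m = j] and its negation are
    projections: guess the sequence, check it and look at its entry [m]. *)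
Lemma Delta11_coordinate F G (f : word Sigma -> nat -> nat) m j :
  rec2 F -> rec2 G ->
  (forall x y, f x =1 y <-> forall n, check F G (code x n) (seq_code (mkseq y n))) ->
  Delta11 (fun x => f x m = j).
Proof.
move=> Frec Grec fP.
have len x n : clen (code x n) = n by rewrite clenE size_map size_mkseq.
have nthy y n : m < n -> cnth (seq_code (mkseq y n)) m = y m.
  by move=> mn; rewrite cnthE nth_mkseq.
have rcheck := recf_check Frec Grec.
split.
  apply: (@Sigma11_bool (fun c d => check F G c d && ((m < clen c) ==> (cnth d m == j)))).
    by apply: (recf_and rcheck); prove_recf.
  move=> x; split=> [fj|[y yP]].
    exists (f x) => n; apply/andP; split; first by have /fP := frefl (f x); apply.
    by rewrite len; apply/implyP => mn; rewrite nthy // fj.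
  have -> : f x m = y m by apply: (fP x y).2 => n; case/andP: (yP n).
  by have /andP[_] := yP m.+1; rewrite len ltnSn nthy // => /eqP.
apply: (@Sigma11_bool (fun c d => check F G c d && ((m < clen c) ==> ~~ (cnth d m == j)))).
  by apply: (recf_and rcheck); prove_recf.
move=> x; split=> [fj|[y yP]].
  exists (f x) => n; apply/andP; split; first by have /fP := frefl (f x); apply.
  by rewrite len; apply/implyP => mn; rewrite nthy //; apply/eqP.
have -> : f x m = y m by apply: (fP x y).2 => n; case/andP: (yP n).
by have /andP[_] := yP m.+1; rewrite len ltnSn nthy // => /eqP.
Qed.

(** The check at length [n] reads only [n] letters and [n] values. *)
Lemma Delta11_check_closed F G (f : word Sigma -> nat -> nat) x y :
  (forall x y, f x =1 y <-> forall n, check F G (code x n) (seq_code (mkseq y n))) ->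
  (forall n, exists x', (forall k, k < n -> x' k = x k) /\ forall k, k < n -> f x' k = y k) ->
  f x =1 y.
Proof.
move=> fP near; apply/fP => n; have [x' [x'x fy]] := near n.
have /fP/(_ n) := frefl (f x'); rewrite /code.
have /mkseq_eqP -> := x'x; by have /mkseq_eqP -> := fy.
Qed.

Lemma Sigma11_represents U : Sigma11 U ->
  exists p F, (forall c d, peval p [:: c; d] (F c d)) /\ represents F U.
Proof.
move=> [Rel [[p pP] UR]].
have /choice [F FP] (cd : nat * nat) : exists k, peval p [:: cd.1; cd.2] k /\ (Rel cd.1 cd.2 <-> k = 0).
  exact: pP cd.1 cd.2.
exists p, (fun c d => F (c, d)); split=> [c d|x]; first by case: (FP (c, d)).
by rewrite UR; split=> -[y yP]; exists y => n; apply/(FP (_, _)).2/yP.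
Qed.

Lemma tau_delta_polish : 2 <= #|Sigma| ->
  polish (@tau_delta Sigma) /\ zero_dimensional (@tau_delta Sigma).
Proof.
move=> card2.
pose K := (GenTree.tree nat * GenTree.tree nat)%type.
pose eval t (F : nat -> nat -> nat) := forall c d, peval (tree_prf t) [:: c; d] (F c d).
pose denotes (t : K) U F G := [/\ eval t.1 F, eval t.2 G, represents F U &
  represents G (fun x => ~ U x)].
have eval_det t F F' : eval t F -> eval t F' -> F = F'.
  by move=> tF tF'; apply/funext => c; apply/funext => d; apply: peval_det (tF c d) (tF' c d).
have eval_rec t F : eval t F -> rec2 F.
  by move=> tF; exists (tree_prf t) => e; apply: tF.
(* A pair of programs that denotes no set together with its complement gets the constant coordinates
   [0]. The last clause can range over every denoted [U] because determinism of evaluation makes it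
   unique. *)
have /choice [f fP] (t : K) : exists f : word Sigma -> nat -> nat,
    [/\ forall m j, tau_delta (fun x => f x m = j),
        forall x y, (forall n, exists x', (forall k, k < n -> x' k = x k) /\
                       forall k, k < n -> f x' k = y k) -> f x =1 y &
        forall U F G, denotes t U F G -> forall x, U x <-> f x 0 <> 0].
  have [[U [F [G [tF tG FU GU]]]]|none] := pselect (exists U F G, denotes t U F G); last first.
    exists (fun _ _ => 0); split=> [m j|x y near m|U F G tU].
    - by apply: generated_local => x j0; exists (fun=> True); split=> //; apply: go_full.
    - by have [x' [_ /(_ m (ltnSn m))]] := near m.+1.
    - by case: none; exists U, F, G.
  have [Frec Grec] := (eval_rec _ _ tF, eval_rec _ _ tG).
  have [f fP Uf] := Delta11_witness Frec Grec FU GU.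
  exists f; split=> [m j|x y|U' F' G' [tF' _ FU' _] x].
  - by apply: go_base; apply: Delta11_coordinate fP.
  - exact: Delta11_check_closed.
  - by rewrite -Uf FU (eval_det _ _ _ tF tF') -FU'.
apply: (@word_polish _ _ _ (K * nat)%type (fun k x => f k.1 x k.2)) => //.
- by move=> m a; apply: go_base; apply: Delta11_letter.
- by move=> [t m] j; have [f_open _ _] := fP t; apply: f_open.
- move=> x s sP [t m] /=; have [_ closed _] := fP t.
  apply: (closed x (fun m => s (t, m))) => n.
  have [x' [x'x x's]] := sP n [seq (t, k) | k <- iota 0 n].
  by exists x'; split=> // k kn; apply: (x's (t, k)); rewrite map_f // mem_iota.
- move=> U x [/Sigma11_represents [p [F [pF FU]]] /Sigma11_represents [q [G [qG GU]]]] Ux.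
  have tU : denotes (prf_tree p, prf_tree q) U F G.
    by split=> // c d; rewrite prf_treeK.
  have [_ _ /(_ _ _ _ tU) Uf] := fP (prf_tree p, prf_tree q).
  exists 0, [:: ((prf_tree p, prf_tree q), 0)] => y _ /(_ _ (mem_head _ _)) /= fy.
  by apply/Uf; rewrite fy; apply/Uf.
Qed.

End Delta.

Theorem theorem1 (Sigma : finType) (z : topo_index) :
  (2 <= #|Sigma|)%N ->
  polish (@tau z Sigma) /\ zero_dimensional (@tau z Sigma).
Proof.
case: z.
- exact: tau_C_polish.
- exact: tau_B_polish.
- exact: tau_A_polish.
- exact: tau_delta_polish.
Qed.
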